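(* Suppose $\psi,\phi:\mathbb{R}\to\mathbb{R}^+$ are unbounded functions with $\psi(x)=\phi(x)=1$ for $x\le1$, each strictly increasing on $[1,\infty)$, and suppose $\phi(x)\ll(\log x)^j$ for all $j>0$, i.e. $\phi(x)/(\log x)^j\to0$ as $x\to\infty$ for every $j>0$. If there exists $k>0$ such that $\frac{[\phi(u)]^{\frac{k}{k+1}}}{\psi(u)}\to\infty$ as $u\to\infty$, then there is a strictly increasing sequence of positive integers that is universally $L\phi(L)$-good but universally $\infty$-sweeping out in $L\psi(L)$.
   Context: All measure-preserving systems $(X,\Sigma,m,T)$ are on probability spaces and are aperiodic (free): for every $n\ge1$ the set $\{x: T^n x=x\}$ has measure zero. For a probability space $(X,\Sigma,m)$, $L\phi(L)=\left\{f:X\to\mathbb{R}\text{ measurable}: \int_X |f|\,\phi(|f|)\,dm<\infty\right\}$, and $L\psi(L)$ is defined in the same way with $\psi$ in place of $\phi$. Let $F$ denote a function space (such as $L\phi(L)$ or $L\psi(L)$) defined on each probability space, and let $S=\{a_1<a_2<\cdots\}$ be a strictly increasing sequence of positive integers. Then $S$ is universally $F$-good iff, for all aperiodic measure-preserving systems $(X,\Sigma,m,T)$ on probability spaces and every $f\in F$, the averages $\frac1N\sum_{n=1}^N f(T^{a_n}x)$ converge (to a finite limit) for a.e. $x$ as $N\to\infty$. $S$ is universally $\infty$-sweeping out in $F$ if for all aperiodic measure-preserving systems $(X,\Sigma,m,T)$ on probability spaces there exists $f\in F$ such that $\sup_N \frac1N\sum_{n=1}^N f(T^{a_n}x)=\infty$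 for almost every $x$.
   Formalization: Sweeping out is claimed only for aperiodic systems on probability spaces whose points are, off a null set, separated by countably many measurable sets (e.g. all standard spaces); for arbitrary probability spaces it fails (irrational rotation with the trivial sigma-algebra). *)

(* Defs.v *)
From HB Require Import structures.
From mathcomp Require Export all_boot all_order all_algebra.
From mathcomp Require Export all_classical all_reals all_analysis.
Export Order.TTheory GRing.Theory Num.Theory.
Export numFieldNormedType.Exports.

Set Implicit Arguments.
Unset Strict Implicit.
Unset Printing Implicit Defensive.

Local Open Scope classical_set_scope.
Local Open Scope ring_scope.

Definition aperiodic_system (R : realType) (d : measure_display)
    (X : measurableType d) (m : probability X R) (T : X -> X) : Prop :=
  [/\ measurable_fun setT T,
      forall A : set X, measurable A -> m (T @^-1` A) = m A &
      forall n : nat, (0 < n)%N -> m.-negligible [set x | iter n T x = x]].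

(* Some countable family of measurable sets separates the points of a conull
   set.  Every standard Borel probability space and every Lebesgue space in
   Rokhlin's sense has this property; neither completeness nor any other
   regularity is required. *)
Definition ae_countably_separated (R : realType) (d : measure_display)
    (X : measurableType d) (m : probability X R) : Prop :=
  exists (A : nat -> set X) (Z : set X),
    [/\ forall i, measurable (A i), m.-negligible Z &
        forall x y, ~ Z x -> ~ Z y -> (forall i, A i x <-> A i y) -> x = y].

Definition function_class (R : realType) : Type :=
  forall (d : measure_display) (X : measurableType d),
    probability X R -> set (X -> R).

(* The class written L phi(L). *)
Definition Lclass (R : realType) (phi : R -> R) : function_class R :=
  fun d X m => [set f : X -> R | measurable_fun setT f /\
    (\int[m]_x (`|f x| * phi `|f x|)%:E < +oo)%E].

(* Sequences are indexed from 0, so [a n] is the (n+1)-st term and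
   [ergodic_average T a f N] is the average over the first N+1 terms. *)
Definition ergodic_average (R : realType) (X : Type) (T : X -> X)
    (a : nat -> nat) (f : X -> R) (N : nat) (x : X) : R :=
  N.+1%:R^-1 * \sum_(n < N.+1) f (iter (a n) T x).

Definition universally_good (R : realType) (F : function_class R)
    (a : nat -> nat) : Prop :=
  forall (d : measure_display) (X : measurableType d) (m : probability X R)
    (T : X -> X), aperiodic_system m T ->
  forall f : X -> R, F d X m f ->
    {ae m, forall x, cvgn (fun N => ergodic_average T a f N x)}.

(* The separation hypothesis expresses the usual convention that probability
   spaces are (at least) standard.  It cannot be dropped: on the circle with
   the trivial sigma-algebra {set0, setT} an irrational rotation has no
   periodic point at all, yet every measurable function is constant, so no
   sequence sweeps out. *)
Definition universally_sweeping_out (R : realType) (F : function_class R)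
    (a : nat -> nat) : Prop :=
  forall (d : measure_display) (X : measurableType d) (m : probability X R)
    (T : X -> X), ae_countably_separated m -> aperiodic_system m T ->
  exists2 f : X -> R, F d X m f &
    {ae m, forall x,
      ereal_sup (range (fun N => (ergodic_average T a f N x)%:E)) = +oo%E}.

(* Main.v *)
(* The sequence consists of stages.  Stage j is a long interval of consecutive
   integers, which exceeds everything before it by a huge factor, followed by a
   perturbation block: an arithmetic progression with difference n_j and residue
   c_j modulo n_j, containing a proportion 1/e_j of the number of terms of the
   interval.  The stages are grouped into levels: level k uses
   e_j = 2^k u_k and n_j = floor (u_k phi(u_k)), and c_j runs through all the
   residues modulo n_j.

   Good.  The intervals satisfy a weak type (1,1) inequality, deduced from the
   maximal ergodic theorem, so that along them the averages of every integrable
   function converge.  The contribution of a perturbation block is at most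
   (1/e_j) times the average of |f| over the block; there the part of |f| below
   u_k contributes at most 2^-k, and the part above u_k is summable over all the
   blocks, because its integral is at most ||f||_{L phi(L)} / phi(u_k).

   Sweeping out.  In an aperiodic system there is a set E_k of measure at most
   3/n_k such that, for all x outside a set of measure 2^-k-1, some residue class
   modulo n_k consists, up to a prescribed bound, of times p with T^p x in E_k.
   One of the perturbation blocks of level k lies in that class, so the function
   equal to 4^k u_k on E_k has an average of size 2^k at x.  Its L psi(L)
   integral is O(4^k psi(4^k u_k) / phi(u_k)).  As phi grows more slowly than
   log, phi(u^2) <= 2 phi(u) for arbitrarily large u; taking u_k among them and
   using psi = o(phi) makes these integrals summable. *)
From mathcomp Require Import lra zify ring.
From mathcomp Require Import measurable_realfun.
Require Import Defs.

Set Implicit Arguments.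
Unset Strict Implicit.
Unset Printing Implicit Defensive.

Local Open Scope classical_set_scope.
Local Open Scope ring_scope.

(** * The sequence *)

Section LexicographicEnumeration.
Local Open Scope nat_scope.
Variable w : nat -> nat.
Hypothesis w_gt0 : forall j, 0 < w j.

(** Used twice: with [w := stage_len] to locate a term in its stage, and with [w := nk] to assign a
    level and a residue to each stage. *)
Fixpoint lex (t : nat) : nat * nat :=
  if t is t'.+1 then
    let ji := lex t' in
    if ji.2.+1 < w ji.1 then (ji.1, ji.2.+1) else (ji.1.+1, 0)
  else (0, 0).

Definition lex_start (j : nat) : nat := \sum_(j' < j) w j'.

Lemma lex_startS j : lex_start j.+1 = lex_start j + w j.
Proof. by rewrite /lex_start big_ord_recr. Qed.

Lemma lex_start_homo i j : i <= j -> lex_start i <= lex_start j.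
Proof.
by move=> /subnK <-; elim: (j - i) => // k IH; rewrite addSn lex_startS; lia.
Qed.

Lemma lex_startD j i : i < w j -> lex (lex_start j + i) = (j, i).
Proof.
elim: j i => [|j IHj].
  rewrite /lex_start big_ord0; elim=> // i IH hi.
  by move: (IH (ltnW hi)); rewrite !add0n /= => -> /=; rewrite hi.
elim=> [_|i IHi hi].
  have /(IHj (w j).-1) : (w j).-1 < w j by have := w_gt0 j; lia.
  rewrite lex_startS; have -> : lex_start j + w j + 0 = (lex_start j + (w j).-1).+1
    by have := w_gt0 j; lia.
  by move=> /= -> /=; have -> : ((w j).-1.+1 < w j) = false by have := w_gt0 j; lia.
by rewrite addnS /= IHi ?(ltnW hi) //= hi.
Qed.

Lemma lexP t : (lex t).2 < w (lex t).1 /\ lex_start (lex t).1 + (lex t).2 = t.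
Proof.
elim: t => [|t [IH1 IH2]] /=; first by rewrite /lex_start big_ord0.
case: ifP => h /=; first by split => //; lia.
by rewrite w_gt0 lex_startS; split => //; lia.
Qed.

Lemma lex_start_ge j : j <= lex_start j.
Proof.
elim: j => // j IH; rewrite lex_startS; have := w_gt0 j; lia.
Qed.

Lemma lex_ge j t : lex_start j <= t -> j <= (lex t).1.
Proof.
move=> h; have [h1 h2] := lexP t; rewrite leqNgt; apply/negP => h3.
have := lex_start_homo h3; rewrite lex_startS; lia.
Qed.

Lemma big_lex (V : nmodType) (G : nat -> nat -> V) j i : i <= w j ->
  (\sum_(t < lex_start j + i) G (lex t).1 (lex t).2 =
   \sum_(j' < j) \sum_(i' < w j') G j' i' + \sum_(i' < i) G j i')%R.
Proof.
elim: j i => [|j IHj] i hi.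
  have s0 : lex_start 0 = 0 by rewrite /lex_start big_ord0.
  rewrite big_ord0 add0r (_ : lex_start 0 + i = i) ?s0 //.
  apply: eq_bigr => t _.
  have := @lex_startD 0 t; rewrite s0 add0n => -> //.
  by rewrite (leq_trans _ hi).
elim: i hi => [_|i IHi hi].
  by rewrite addn0 lex_startS IHj // big_ord0 addr0 big_ord_recr.
rewrite addnS big_ord_recr /= IHi ?(ltnW hi) // lex_startD //=.
by rewrite -addrA; congr (_ + _)%R; rewrite big_ord_recr.
Qed.

End LexicographicEnumeration.

Section BlockSequence.
Local Open Scope nat_scope.
Variables e n c : nat -> nat.
Hypothesis e_gt0 : forall j, 0 < e j.
Hypothesis n_gt0 : forall j, 0 < n j.

(** The body is [base_startS] with all lengths unfolded. Starting at 1 keeps the terms positive, and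
    the factor [2 ^ i] makes stage [i] far longer than everything before it. *)
Fixpoint base_start (j : nat) : nat :=
  if j is i.+1 then
    let M := base_start i in
    n i * (M + e i * (2 ^ i * M)) + c i + n i * (2 ^ i * M)
  else 1.

Definition pert_len j := 2 ^ j * base_start j.
Definition base_len j := e j * pert_len j.
Definition pert_start j := n j * (base_start j + base_len j) + c j.
Definition stage_len j := base_len j + pert_len j.

Definition stage_term (j i : nat) : nat :=
  if i < base_len j then base_start j + i
  else pert_start j + n j * (i - base_len j).

Definition stage_of (t : nat) := lex stage_len t.
Definition stage_pos (j : nat) := lex_start stage_len j.
Definition block_seq (t : nat) := stage_term (stage_of t).1 (stage_of t).2.
Definition is_base (t : nat) := (stage_of t).2 < base_len (stage_of t).1.

Lemma base_startS j : base_start j.+1 = pert_start j + n j * pert_len j.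
Proof. by []. Qed.

Lemma base_start_gt0 j : 0 < base_start j.
Proof.
elim: j => // j IH; rewrite base_startS /pert_start; have := n_gt0 j.
by rewrite !addn_gt0 !muln_gt0 !addn_gt0 IH => ->.
Qed.

Lemma base_lenE j : base_len j = e j * pert_len j.
Proof. by []. Qed.

Lemma pert_len_gt0 j : 0 < pert_len j.
Proof. by rewrite muln_gt0 expn_gt0 base_start_gt0. Qed.

Lemma base_len_ge j : pert_len j <= base_len j.
Proof. by rewrite leq_pmull. Qed.

Lemma base_len_gt0 j : 0 < base_len j.
Proof. exact: leq_trans (pert_len_gt0 j) (base_len_ge j). Qed.

Lemma stage_len_gt0 j : 0 < stage_len j.
Proof. by rewrite addn_gt0 base_len_gt0. Qed.

Lemma pert_start_ge j : base_start j + base_len j <= pert_start j.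
Proof. by have := leq_pmull (base_start j + base_len j) (n_gt0 j); rewrite /pert_start; lia. Qed.

Lemma pert_lenM_ge j : pert_len j <= n j * pert_len j.
Proof. by rewrite leq_pmull. Qed.

Lemma base_start_le i j : i <= j -> base_start i <= base_start j.
Proof.
move=> /subnK <-; elim: (j - i) => // k IH; rewrite addSn base_startS.
have := pert_start_ge (k + i); lia.
Qed.

Lemma stage_posS j : stage_pos j.+1 = stage_pos j + stage_len j.
Proof. exact: lex_startS. Qed.

(** Each stage moves the values forward by at least its number of terms. Thus
    [base_start j - stage_pos j], used later as a time, is never truncated. *)
Lemma stage_pos_le j : stage_pos j <= base_start j.
Proof.
elim: j => [|j IH]; first by rewrite /stage_pos /lex_start big_ord0.
rewrite stage_posS base_startS /stage_len.
have := pert_start_ge j; have := pert_lenM_ge j; lia.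
Qed.

Lemma stage_pos_ge j : 2 ^ j * base_start j <= stage_pos j.+1.
Proof. by rewrite stage_posS addnA leq_addl. Qed.

Lemma stage_pos_homo i j : i <= j -> stage_pos i <= stage_pos j.
Proof. exact: lex_start_homo. Qed.

Lemma base_len_start j : base_start j <= base_len j.
Proof.
apply: leq_trans (base_len_ge j); rewrite /pert_len leq_pmull // expn_gt0 //.
Qed.

Lemma block_seq_gt0 t : 0 < block_seq t.
Proof.
rewrite /block_seq /stage_term; set j := (stage_of t).1; case: ifP => _.
  by rewrite addn_gt0 base_start_gt0.
rewrite ltn_addr // (leq_trans _ (pert_start_ge j)) //.
by rewrite addn_gt0 base_start_gt0.
Qed.

Lemma block_seqS t : block_seq t < block_seq t.+1.
Proof.
rewrite /block_seq /stage_of /=; have [h1 _] := lexP stage_len_gt0 t.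
move: h1; set j := (lex _ t).1; set i := (lex _ t).2 => hi.
case: ifP => h /=.
  rewrite /stage_term; case: ifP => h1; case: ifP => h2; [lia| |lia|].
    by have := pert_start_ge j; lia.
  by rewrite subSn ?mulnS; [have := n_gt0 j; lia | lia].
(* Passage to the next stage: [base_start j.+1] is the value that the progression of stage [j] would
   take one step after its last term. *)
rewrite /stage_term base_len_gt0 addn0 base_startS.
have -> : (i < base_len j) = false.
  by move: h hi; rewrite /stage_len; have := pert_len_gt0 j; lia.
rewrite ltn_add2l ltn_pmul2l //; move: hi; rewrite /stage_len.
by have := pert_len_gt0 j; lia.
Qed.

Lemma block_seq_lt s t : s < t -> block_seq s < block_seq t.
Proof. by apply: (homo_ltn ltn_trans); exact: block_seqS. Qed.

Lemma stage_split N : exists j i,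
  [/\ N = stage_pos j + i, i < stage_len j & forall j', stage_pos j' <= N -> j' <= j].
Proof.
have [h1 h2] := lexP stage_len_gt0 N.
exists (lex stage_len N).1, (lex stage_len N).2; split => //.
by move=> j' h; apply: lex_ge => //; exact: stage_len_gt0.
Qed.

Lemma big_stage (V : nmodType) (G : nat -> nat -> V) j i : i <= stage_len j ->
  (\sum_(t < stage_pos j + i) G (stage_of t).1 (stage_of t).2 =
   \sum_(j' < j) \sum_(i' < stage_len j') G j' i' + \sum_(i' < i) G j i')%R.
Proof. exact: (big_lex stage_len_gt0). Qed.

Lemma big_ord_cut (V : nmodType) (G : nat -> V) (k i : nat) :
  (\sum_(i' < i) (if (i' < k)%N then G i' else 0) = \sum_(i' < minn i k) G i')%R.
Proof.
elim: i => [|i IH]; first by rewrite min0n !big_ord0.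
rewrite big_ord_recr /= IH; case: ltnP => h.
  have -> : minn i.+1 k = i.+1 by lia.
  by rewrite big_ord_recr.
have -> : minn i.+1 k = k by lia.
by rewrite addr0.
Qed.

Lemma big_base (V : nmodType) (F : nat -> V) j i : i <= stage_len j ->
  (\sum_(t < stage_pos j + i | is_base t) F (block_seq t) =
   \sum_(j' < j) \sum_(i' < base_len j') F (base_start j' + i')
   + \sum_(i' < minn i (base_len j)) F (base_start j + i'))%R.
Proof.
move=> hi; rewrite big_mkcond /=.
pose G j i := (if i < base_len j then F (base_start j + i) else 0%R).
transitivity (\sum_(t < stage_pos j + i) G (stage_of t).1 (stage_of t).2)%R.
  apply: eq_bigr => t _; rewrite /is_base /G /block_seq /stage_term.
  by case: (_ < _)%N.
rewrite big_stage // /G; congr (_ + _)%R; last first.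
  exact: (big_ord_cut (fun i' => F (base_start j + i'))).
apply: eq_bigr => j' _; rewrite (big_ord_cut (fun i' => F (base_start j' + i'))).
have -> : minn (stage_len j') (base_len j') = base_len j' by rewrite /stage_len; lia.
by [].
Qed.

Lemma big_pert (V : nmodType) (F : nat -> V) j i : i <= stage_len j ->
  (\sum_(t < stage_pos j + i | ~~ is_base t) F (block_seq t) =
   \sum_(j' < j) \sum_(i' < pert_len j') F (pert_start j' + n j' * i')%N
   + \sum_(i' < i - base_len j) F (pert_start j + n j * i')%N)%R.
Proof.
move=> hi; rewrite big_mkcond /=.
pose G j i := (if i < base_len j then 0%R else F (pert_start j + n j * (i - base_len j))).
transitivity (\sum_(t < stage_pos j + i) G (stage_of t).1 (stage_of t).2)%R.
  apply: eq_bigr => t _; rewrite /is_base /G /block_seq /stage_term.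
  by case: ltnP.
have cut j1 i1 : (\sum_(i' < i1) G j1 i' =
    \sum_(i' < i1 - base_len j1) F (pert_start j1 + n j1 * i')%N)%R.
  elim: i1 => [|i1 IH]; first by rewrite !big_ord0.
  rewrite big_ord_recr /= IH /G; case: ltnP => h.
    by rewrite addr0; have -> : i1 - base_len j1 = i1.+1 - base_len j1 by lia.
  by rewrite subSn // big_ord_recr.
rewrite big_stage // cut; congr (_ + _)%R.
by apply: eq_bigr => j' _; rewrite cut /stage_len addKn.
Qed.

End BlockSequence.

(** * Bounds for sums along the sequence *)

Section BlockSums.
Variable R : realType.
Variables e n c : nat -> nat.
Hypothesis e_gt0 : forall j, (0 < e j)%N.
Hypothesis n_gt0 : forall j, (0 < n j)%N.

Local Notation base_start := (base_start e n c).
Local Notation base_len := (base_len e n c).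
Local Notation pert_start := (pert_start e n c).
Local Notation pert_len := (pert_len e n c).
Local Notation stage_len := (stage_len e n c).
Local Notation stage_pos := (stage_pos e n c).
Local Notation block_seq := (block_seq e n c).
Local Notation is_base := (is_base e n c).

(** The finitely many stages before [J] go into the constant [C]; the others cost at most [eps]
    times their base length, and these lengths sum to at most [stage_pos j]. *)
Lemma sum_stage_le (g : nat -> R) (eps : R) (J : nat) : 0 <= eps ->
  (forall j, (J <= j)%N -> g j <= eps * (base_len j)%:R) ->
  exists2 C : R, 0 <= C &
    forall j, \sum_(j' < j) g j' <= C + eps * (stage_pos j)%:R.
Proof.
move=> eps0 hg; exists (\sum_(j' < J) `|g j'|); first exact: sumr_ge0.
move=> j; apply: (@le_trans _ _ (\sum_(j' < j)
    ((if (j' < J)%N then `|g j'| else 0) + eps * (base_len j')%:R))).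
  apply: ler_sum => j' _; case: ltnP => h; last by rewrite add0r hg.
  by rewrite (le_trans (ler_norm _))// lerDl mulr_ge0.
rewrite big_split /=; apply: lerD.
  rewrite (big_ord_cut (fun j' => `|g j'|)) -[leRHS](big_mkord xpredT (fun j' => `|g j'|)).
  rewrite -(big_mkord xpredT (fun j' => `|g j'|)).
  rewrite [leRHS](@big_cat_nat _ _ _ (minn j J)) ?geq_minr //= lerDl.
  exact: sumr_ge0.
rewrite -mulr_sumr ler_wpM2l // -natr_sum ler_nat.
by apply: leq_sum => j' _; rewrite /stage_len leq_addr.
Qed.

(** A complete base block costs at most [2 * lam] times its length, because [stage_pos j' <=
    base_start j' <= base_len j']; the current, possibly incomplete, block accounts for the third
    [lam]. *)
Lemma base_sum_le (F : nat -> R) (lam : R) : 0 <= lam ->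
  (forall j t, (t <= base_len j)%N ->
     \sum_(i < t) F (base_start j + i)%N <= lam * (stage_pos j + t)%:R) ->
  forall N, \sum_(t < N | is_base t) F (block_seq t) <= 3 * lam * N%:R.
Proof.
move=> lam0 hF N.
have [j [i [-> hi _]]] := @stage_split e n c e_gt0 n_gt0 N.
rewrite (@big_base e n c e_gt0 n_gt0) ?(ltnW hi) //.
apply: (@le_trans _ _ (2 * lam * (stage_pos j)%:R
    + lam * (stage_pos j + minn i (base_len j))%:R)); last first.
  rewrite !natrD.
  have : (minn i (base_len j))%:R <= i%:R :> R by rewrite ler_nat geq_minl.
  have : 0 <= i%:R :> R by [].
  nra.
apply: lerD; last by apply: hF; rewrite geq_minr.
apply: (@le_trans _ _ (\sum_(j' < j) 2 * lam * (stage_len j')%:R)); last first.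
  by rewrite -mulr_sumr -natr_sum.
apply: ler_sum => j' _; rewrite (le_trans (hF _ _ (leqnn _)))//.
rewrite (mulrC 2) -mulrA ler_wpM2l // -natrM ler_nat.
have := @stage_pos_le e n c n_gt0 j'.
have := @base_len_start e n c e_gt0 j'.
by rewrite /stage_len; lia.
Qed.

Lemma pert_sum_le (F : nat -> R) (eps : R) (J : nat) : 0 <= eps ->
  (forall s, 0 <= F s) ->
  (forall j, (J <= j)%N ->
    \sum_(i < pert_len j) F (pert_start j + n j * i)%N <= eps * (base_len j)%:R) ->
  exists2 C : R, 0 <= C & forall N,
    \sum_(t < N | ~~ is_base t) F (block_seq t) <= C + eps * N%:R.
Proof.
move=> eps0 F0 hF.
have [C1 C10 hC1] := sum_stage_le eps0 hF.
pose g j := \sum_(i < pert_len j) F (pert_start j + n j * i)%N.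
pose C2 := \sum_(j < J) g j.
have g0 j : 0 <= g j by apply: sumr_ge0.
have C20 : 0 <= C2 by apply: sumr_ge0.
exists (C1 + C2); first by rewrite addr_ge0.
move=> N; have [j [i [-> hi _]]] := @stage_split e n c e_gt0 n_gt0 N.
rewrite (@big_pert e n c e_gt0 n_gt0) ?(ltnW hi) //.
rewrite natrD mulrDr addrACA; apply: lerD; first exact: hC1.
(* An incomplete perturbation block is bounded by the complete one, since [F] is nonnegative, and
   its cost is paid by the base block of the same stage, already traversed. *)
have part : \sum_(i' < i - base_len j) F (pert_start j + n j * i')%N <= g j.
  rewrite /g -!(big_mkord xpredT (fun i => F (pert_start j + n j * i)%N)).
  rewrite [leRHS](@big_cat_nat _ _ _ (i - base_len j)) //=; last first.
    by move: hi; rewrite /stage_len; lia.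
  by rewrite lerDl sumr_ge0.
have [hij|hij] := leqP i (base_len j).
  move/eqP: hij => ->; rewrite big_ord0 addr_ge0 // mulr_ge0 //.
apply: (le_trans part); have [hJ|hJ] := leqP J j.
  rewrite (le_trans (hF _ hJ))// -[leLHS]add0r lerD // ler_wpM2l // ler_nat.
  exact: ltnW.
rewrite /C2 (bigD1 (Ordinal hJ)) //= -addrA lerDl addr_ge0 ?mulr_ge0 //.
exact: sumr_ge0.
Qed.

Lemma shift_sum_le (F : nat -> R) (C : R) (s r t : nat) : (forall i, `|F i| <= C) ->
  `|\sum_(i < t) F (s + i)%N - \sum_(i < t) F (s + i + r)%N| <= 2 * C * r%:R.
Proof.
move=> FC; elim: r => [|r IH].
  by under [X in _ - X]eq_bigr do rewrite addn0; rewrite subrr normr0 mulr0.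
have -> : \sum_(i < t) F (s + i + r.+1)%N =
    \sum_(i < t) F (s + i + r)%N + (F (s + t + r)%N - F (s + r)%N).
  elim: t {IH} => [|t IHt]; first by rewrite !big_ord0 addn0 subrr addr0.
  rewrite !big_ord_recr /= IHt (_ : s + t + r.+1 = s + t.+1 + r)%N; last by lia.
  by ring.
rewrite opprD addrA (le_trans (ler_normB _ _))//.
rewrite -[r.+1%:R]natr1 mulrDr mulr1 lerD // (le_trans (ler_normB _ _))//.
by rewrite mulr_natl mulr2n lerD.
Qed.

(** This allows [F] to be replaced by its averages over [m] consecutive integers: on each block the
    error consists of boundary terms of total size at most [B], while the block lengths tend to
    infinity. *)
Lemma base_sum_shift (F : nat -> R) (C : R) (m : nat) : (0 < m)%N ->
  (forall i, `|F i| <= C) -> forall eps, 0 < eps ->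
  exists2 D : R, 0 <= D & forall N,
    `|\sum_(t < N | is_base t)
        (F (block_seq t) - m%:R^-1 * \sum_(r < m) F (block_seq t + r)%N)|
    <= D + eps * N%:R.
Proof.
move=> m0 FC eps eps0.
have C0 : 0 <= C by rewrite (le_trans _ (FC 0%N)).
set B := 2 * C * m%:R.
have B0 : 0 <= B by rewrite !mulr_ge0.
pose H s := F s - m%:R^-1 * \sum_(r < m) F (s + r)%N.
have blk s t : `|\sum_(i < t) H (s + i)%N| <= B.
  have -> : \sum_(i < t) H (s + i)%N = m%:R^-1 *
      \sum_(r < m) (\sum_(i < t) F (s + i)%N - \sum_(i < t) F (s + i + r)%N).
    rewrite [in RHS]sumrB sumr_const card_ord mulrBr -[(\sum_(_ < t) _) *+ m]mulr_natl.
    rewrite mulKf ?pnatr_eq0 -?lt0n //.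
    by rewrite exchange_big /= /H sumrB mulr_sumr.
  rewrite normrM ger0_norm ?invr_ge0 // ler_pdivrMl ?ltr0n //.
  rewrite (le_trans (ler_norm_sum _ _ _))//.
  apply: (@le_trans _ _ (\sum_(r < m) B)); last first.
    by rewrite sumr_const card_ord mulr_natl.
  apply: ler_sum => r _; rewrite (le_trans (shift_sum_le _ _ _ FC))//.
  by rewrite ler_wpM2l ?mulr_ge0 // ler_nat ltnW.
(* For [J <= j] one has [B / eps <= J <= 2 ^ j <= base_len j]. *)
pose J := Num.bound (B / eps).
have hJ j : (J <= j)%N -> B <= eps * (base_len j)%:R.
  move=> Jj; rewrite mulrC -ler_pdivrMr //.
  rewrite (@le_trans _ _ J%:R) //.
    by rewrite ltW // archi_boundP // divr_ge0 // ltW.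
  rewrite ler_nat (leq_trans Jj) // (leq_trans _ (@base_len_ge e n c e_gt0 j)) //.
  rewrite /pert_len (leq_trans (ltnW (ltn_expl j (ltnSn 1)))) // leq_pmulr //.
  exact: base_start_gt0.
have [C1 C10 hC1] := @sum_stage_le (fun=> B) eps J (ltW eps0) hJ.
exists (C1 + B); first by rewrite addr_ge0.
move=> N; have [j [i [-> hi _]]] := @stage_split e n c e_gt0 n_gt0 N.
rewrite (@big_base e n c e_gt0 n_gt0 _ H) ?(ltnW hi) //.
rewrite (le_trans (ler_normD _ _))//.
apply: (@le_trans _ _ ((C1 + eps * (stage_pos j)%:R) + B)); last first.
  rewrite addrAC lerD2l natrD mulrDr lerDl mulr_ge0 // ltW //.
apply: lerD; last exact: blk.
by rewrite (le_trans _ (hC1 j))// (le_trans (ler_norm_sum _ _ _))// ler_sum.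
Qed.

End BlockSums.

(** * The maximal ergodic theorem *)

Section MeasurePreserving.
Context (R : realType) (d : measure_display) (X : measurableType d).
Variables (m : probability X R) (T : X -> X).
Hypothesis mT : measurable_fun setT T.
Hypothesis Tinv : forall A : set X, measurable A -> m (T @^-1` A) = m A.

Lemma measurable_preimage (f : X -> X) (A : set X) :
  measurable_fun setT f -> measurable A -> measurable (f @^-1` A).
Proof. by move=> mf mA; rewrite -[_ @^-1` _]setTI; exact: mf. Qed.

Lemma norm_le_bounded (h : X -> R) (C : R) (A : set X) :
  (forall x, `|h x| <= C) -> [bounded h x | x in A].
Proof.
by move=> hC; exists C; split; [exact: num_real|move=> r Cr x _ /=; rewrite (le_trans (hC x)) ?ltW].
Qed.

Lemma measurable_gt (f : X -> R) a :
  measurable_fun setT f -> measurable [set x | a < f x].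
Proof.
move=> mf; have -> : [set x | a < f x] = setT `&` f @^-1` `]a, +oo[.
  by apply/seteqP; split => x /=; rewrite in_itv /= andbT => // -[].
exact: mf.
Qed.

Lemma measurable_iter n : measurable_fun setT (iter n T).
Proof.
elim: n => [|n IH]; first exact: measurable_id.
exact: (measurableT_comp mT IH).
Qed.

Lemma measurable_iter_preimage n (A : set X) :
  measurable A -> measurable (iter n T @^-1` A).
Proof. exact/measurable_preimage/measurable_iter. Qed.

Lemma measure_iter n (A : set X) : measurable A -> m (iter n T @^-1` A) = m A.
Proof.
elim: n A => // n IH A mA.
by rewrite -[RHS]Tinv // -[RHS]IH //; exact: measurable_preimage.
Qed.

Lemma measurable_comp_iter n d' (Y : measurableType d') (f : X -> Y) :
  measurable_fun setT f -> measurable_fun setT (fun x => f (iter n T x)).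
Proof. by move=> mf; exact: (measurableT_comp mf (measurable_iter n)). Qed.

Lemma ge0_integral_iter n (f : X -> \bar R) : measurable_fun setT f ->
  (forall x, 0 <= f x)%E ->
  (\int[m]_x f (iter n T x) = \int[m]_x f x)%E.
Proof.
move=> mf f0.
rewrite -[LHS](@ge0_integral_pushforward _ _ _ _ _ _ (measurable_iter n) m setT f) //.
apply: eq_measure_integral => [|mf1 A mA _]; [exact: measurable_iter|exact: (measure_iter n mA)].
Qed.

Lemma integrable_iter n (f : X -> \bar R) : m.-integrable setT f ->
  m.-integrable setT (fun x => f (iter n T x)).
Proof.
move=> /integrableP[mf fi]; apply/integrableP; split.
  exact: measurable_comp_iter.
rewrite (@ge0_integral_iter n (fun x => `|f x|%E)) //.
exact: measurableT_comp.
Qed.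

Lemma integral_iter n (f : X -> \bar R) : m.-integrable setT f ->
  (\int[m]_x f (iter n T x) = \int[m]_x f x)%E.
Proof.
move=> fi; have /integrableP[mf _] := fi.
rewrite -[LHS](@integral_pushforward _ _ _ _ _ _ (measurable_iter n) m setT f) //.
  apply: eq_measure_integral => [|mf1 A mA _]; first exact: measurable_iter.
  exact: (measure_iter n mA).
exact: integrable_iter.
Qed.

Definition birkhoff_sum (f : X -> R) n x : R := \sum_(i < n) f (iter i T x).

Lemma birkhoff_sumS f n x :
  birkhoff_sum f n.+1 x = f x + birkhoff_sum f n (T x).
Proof.
rewrite /birkhoff_sum big_ord_recl /=; congr (_ + _).
by apply: eq_bigr => i _; rewrite /= -iterSr.
Qed.

Lemma measurable_birkhoff_sum f n : measurable_fun setT f ->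
  measurable_fun setT (birkhoff_sum f n).
Proof.
move=> mf; rewrite /birkhoff_sum; apply: measurable_sum => i.
exact: measurable_comp_iter.
Qed.

(* The maximum of [0] and of the Birkhoff sums of length at most [n]. *)
Fixpoint birkhoff_max (h : X -> R) (n : nat) (x : X) : R :=
  if n is n'.+1 then Num.max 0 (h x + birkhoff_max h n' (T x)) else 0.

Lemma birkhoff_max_ge0 h n x : 0 <= birkhoff_max h n x.
Proof. by case: n => //= n; rewrite le_max lexx. Qed.

Lemma birkhoff_maxS h n x : birkhoff_max h n x <= birkhoff_max h n.+1 x.
Proof.
elim: n x => [|n IH] x; first exact: birkhoff_max_ge0.
rewrite [leLHS]/= [leRHS]/=.
by rewrite ge_max le_max lexx /= le_max lerD2l IH orbT.
Qed.

Lemma birkhoff_max_le h k n x : (k <= n)%N ->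
  birkhoff_max h k x <= birkhoff_max h n x.
Proof.
move=> /subnK <-; elim: (n - k)%N => // i IH.
by rewrite addSn (le_trans IH) // birkhoff_maxS.
Qed.

Lemma birkhoff_max_gt0 h n x : 0 < birkhoff_max h n x ->
  exists2 k, (0 < k)%N & 0 < birkhoff_sum h k x.
Proof.
move=> h0; have [k [k0 _ hk]] : exists k,
    [/\ (0 < k)%N, (k <= n)%N & birkhoff_max h n x <= birkhoff_sum h k x].
  elim: n x h0 => [|n IH] x; first by rewrite ltxx.
  rewrite [birkhoff_max _ _ _]/= lt_max ltxx /= => h0.
  rewrite max_r ?ltW //.
  have [/IH[k [k0 kn hk]]|hle] := ltP 0 (birkhoff_max h n (T x)).
    by exists k.+1; split; rewrite // birkhoff_sumS lerD2l.
  exists 1%N; split => //; rewrite birkhoff_sumS /birkhoff_sum big_ord0 lerD2l //.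
by exists k => //; exact: lt_le_trans hk.
Qed.

Lemma birkhoff_sum_le_max h n x : birkhoff_sum h n x <= birkhoff_max h n x.
Proof.
elim: n x => [|n IH] x; first by rewrite /birkhoff_sum big_ord0.
by rewrite birkhoff_sumS [leRHS]/= le_max lerD2l IH orbT.
Qed.

Lemma integrable_birkhoff_max h n : m.-integrable setT (EFin \o h) ->
  m.-integrable setT (EFin \o birkhoff_max h n).
Proof.
move=> hi; elim: n => [|n IH]; first exact: integrable0.
have hi' := integrableD measurableT hi (integrable_iter 1 IH).
apply: (@eq_integrable _ _ _ _ _ measurableT
  (fun x => maxe 0 ((EFin \o h) x + (EFin \o birkhoff_max h n) (iter 1 T x)))%E).
  by move=> x _ /=; rewrite EFin_max.
have := integrable_funepos measurableT hi'.
by apply: eq_integrable => // x _; rewrite funeposE maxC.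
Qed.

(* On [birkhoff_max h n.+1 > 0] one has
   [h = birkhoff_max h n.+1 - birkhoff_max h n \o T
     >= birkhoff_max h n.+1 - birkhoff_max h n.+1 \o T],
   and the right-hand side has integral zero. *)
Lemma maximal_ergodic h n : m.-integrable setT (EFin \o h) ->
  (0 <= \int[m]_x (h x * \1_[set y | 0 < birkhoff_max h n.+1 y]%R x)%:E)%E.
Proof.
move=> hi; set D := [set y | _].
have Mi := integrable_birkhoff_max n.+1 hi.
have /integrableP[/measurable_EFinP mM _] := Mi.
have mD : measurable D.
  exact: measurable_gt.
have -> : (0 = \int[m]_x ((EFin \o birkhoff_max h n.+1) x
     - (EFin \o birkhoff_max h n.+1) (iter 1 T x)))%E.
  rewrite integralB //; last exact: integrable_iter.
  rewrite (integral_iter 1 Mi) subee //; exact: integrable_fin_num.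
apply: le_integral => //.
- by apply: integrableB => //; exact: integrable_iter.
- have bD : [bounded (\1_D : X -> R) x | x in setT].
    by apply: (@norm_le_bounded _ 1) => x; rewrite indicE normr_nat lern1 leq_b1.
  by apply: eq_integrable (integrableMl measurableT hi (measurable_indic mD) bD) => // x _;
    rewrite EFinM.
move=> x _ /=; rewrite -EFinB lee_fin indicE.
have [xD|xD] := boolP (x \in D).
  rewrite mulr1 lerBlDr.
  move: xD; rewrite inE /D /= lt_max ltxx /= => xD.
  rewrite max_r; last exact: ltW.
  by rewrite lerD2l; exact: (birkhoff_maxS h n).
rewrite mulr0 subr_le0; move: xD; rewrite notin_setE /D /= => /negP.
rewrite -leNgt => /le_trans; apply; exact: (birkhoff_max_ge0 h n.+1).
Qed.

End MeasurePreserving.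

Section DisjointFamilies.
Context (R : realType) (d : measure_display) (X : measurableType d).
Variable m : probability X R.

Lemma le_measure_subset (A B : set X) :
  measurable A -> measurable B -> A `<=` B -> (m A <= m B)%E.
Proof. by move=> mA mB AB; apply: le_measure; rewrite ?inE. Qed.

Lemma sum_measure_disjoint_le (F : nat -> set X) (A : set X) (N : nat) :
  (forall i, measurable (F i)) -> measurable A ->
  (forall i j, (i < j)%N -> (j < N)%N -> F i `&` F j = set0) ->
  (forall i, (i < N)%N -> F i `<=` A) -> (\sum_(i < N) m (F i) <= m A)%E.
Proof.
move=> mF mA disj FA.
have tF : trivIset `I_N F.
  apply/trivIsetP => i j iN jN; rewrite neq_ltn => /orP[ij|ji]; first exact: disj.
  by rewrite setIC disj.
have := @measure_fin_bigcup _ _ _ m _ `I_N F (finite_II N) tF (fun i _ => mF i).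
rewrite -fsbig_ord => <-; apply: le_measure_subset => //.
  exact: bigcup_measurable.
by move=> x [i /= iN Fx]; exact: FA Fx.
Qed.

Lemma series_measure_disjoint_le (F : nat -> set X) (A : set X) :
  (forall i, measurable (F i)) -> measurable A -> trivIset setT F ->
  (forall i, F i `<=` A) -> (\sum_(i <oo) m (F i) <= m A)%E.
Proof.
move=> mF mA tF FA.
have := @measure_bigcup _ _ _ m setT F (fun i _ => mF i) tF.
under eq_eseriesl do rewrite in_setT.
move=> <-; apply: le_measure_subset => //.
  exact: bigcup_measurable.
by move=> x [i _ Fx]; exact: FA Fx.
Qed.

Lemma fin_num_prob (A : set X) : measurable A -> m A \is a fin_num.
Proof. by move=> mA; exact: fin_num_measure. Qed.

End DisjointFamilies.

(** * A weak type inequality for long runs in a set *)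

Section WeakType.
Context (R : realType) (d : measure_display) (X : measurableType d).
Variables (m : probability X R) (T : X -> X).
Hypothesis mT : measurable_fun setT T.
Hypothesis Tinv : forall A : set X, measurable A -> m (T @^-1` A) = m A.

Definition excess_set (g : X -> R) (lam : R) : set X :=
  [set x | exists k, lam * k%:R < birkhoff_sum T g k x].

Lemma excess_setE g lam : excess_set g lam =
  \bigcup_n [set x | 0 < birkhoff_max T (fun y => g y - lam) n.+1 x].
Proof.
have sumE k x : birkhoff_sum T (fun y => g y - lam) k x =
    birkhoff_sum T g k x - lam * k%:R.
  by rewrite /birkhoff_sum sumrB sumr_const card_ord mulr_natr.
apply/seteqP; split => x.
  move=> [[|k]]; first by rewrite /birkhoff_sum big_ord0 mulr0 ltxx.
  move=> hk; exists k => //; apply: lt_le_trans (birkhoff_sum_le_max _ _ k.+1 x).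
  by rewrite sumE subr_gt0.
move=> [k _ hk]; have [i i0] := birkhoff_max_gt0 hk.
by rewrite sumE subr_gt0 => h; exists i.
Qed.

Lemma measurable_excess_set g lam : measurable_fun setT g ->
  measurable (excess_set g lam).
Proof.
move=> mg; rewrite excess_setE; apply: bigcup_measurable => n _.
apply: measurable_gt; elim: n.+1 => [|k IH] /=; first exact: measurable_cst.
apply: measurable_maxr; first exact: measurable_cst.
apply: measurable_funD; first exact: measurable_funB.
exact: measurableT_comp IH mT.
Qed.

(** The maximal ergodic theorem for [g - lam] bounds [lam * m (D n)] by the integral of [g] over
    [D n], and the sets [D n] increase to the excess set. *)
Lemma excess_set_measure g lam : 0 < lam -> (forall x, 0 <= g x) ->
  m.-integrable setT (EFin \o g) ->
  (m (excess_set g lam) <= lam^-1%:E * \int[m]_x (g x)%:E)%E.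
Proof.
move=> lam0 g0 gi; have /integrableP[/measurable_EFinP mg _] := gi.
pose h y := g y - lam; pose D n := [set x | 0 < birkhoff_max T h n.+1 x].
have hi : m.-integrable setT (EFin \o h).
  have := integrableB measurableT gi (finite_measure_integrable_cst m lam measurableT).
  by apply: eq_integrable.
have mD n : measurable (D n).
  have /integrableP[/measurable_EFinP mM _] := integrable_birkhoff_max mT Tinv n.+1 hi.
  exact: measurable_gt.
have Dle n : (m (D n) <= lam^-1%:E * \int[m]_x (g x)%:E)%E.
  have := maximal_ergodic mT Tinv n hi; rewrite -/(D n).
  have gDi : m.-integrable setT (fun x => (g x * \1_(D n) x)%:E).
    apply: le_integrable gi => //.
      by apply/measurable_EFinP; apply: measurable_funM => //; exact: measurable_indic.
    move=> x _ /=; rewrite lee_fin !ger0_norm ?mulr_ge0 //.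
    by rewrite ler_piMr // indicE lern1 leq_b1.
  have lDi : m.-integrable setT (fun x => (lam%:E * (\1_(D n) x)%:E)%E).
    by apply: integrableZl => //; exact: integrable_indic.
  rewrite (_ : (\int[m]_x _)%E = (\int[m]_x (g x * \1_(D n) x)%:E
      - lam%:E * m (D n))%E); last first.
    have -> : m (D n) = (\int[m]_x (\1_(D n) x)%:E)%E by rewrite integral_indic // setIT.
    rewrite -integralZl //; last exact: integrable_indic.
    rewrite -integralB //; apply: eq_integral => x _.
    by rewrite -EFinM -EFinB /h mulrBl.
  rewrite sube_ge0 ?fin_numM ?fin_num_prob // => h1.
  rewrite lee_pdivlMl //; apply: (le_trans h1).
  apply: le_integral => // x _; rewrite lee_fin.
  by rewrite ler_piMr // indicE lern1 leq_b1.
have cD : m (D n) @[n --> \oo] --> m (\bigcup_n D n).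
  apply: nondecreasing_cvg_mu => //; first exact: bigcup_measurable.
  apply/nondecreasing_seqP => n; apply/subsetPset => x /=.
  by move=> /lt_le_trans; apply; exact: (birkhoff_maxS T h n.+1).
rewrite excess_setE -/(h) -(cvg_lim _ cD) //; apply: lime_le.
  by apply/cvg_ex; exists (m (\bigcup_n D n)).
exact: nearW.
Qed.

Definition run_set (D : set X) (N : nat) : set X :=
  [set y | forall i, (i <= N)%N -> D (iter i T y)].

Lemma measurable_run_set D N : measurable D -> measurable (run_set D N).
Proof.
move=> mD; have -> : run_set D N = \bigcap_(i in [set i | (i <= N)%N]) iter i T @^-1` D.
  by apply/seteqP; split => x h i iN; exact: h.
by apply: bigcap_measurable => [|i _]; [exists 0%N|exact: measurable_iter_preimage].
Qed.

Lemma run_set_sub D N N' : (N <= N')%N -> run_set D N' `<=` run_set D N.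
Proof. by move=> h x hx i iN; apply: hx; exact: leq_trans h. Qed.

(** As [T] need not be invertible, the start of a run is recorded by the point just before it, which
    lies outside [D]. *)
Definition run_entry (D : set X) (N : nat) : set X :=
  ~` D `&` T @^-1` run_set D N.

Lemma measurable_run_entry D N : measurable D -> measurable (run_entry D N).
Proof.
move=> mD; apply: measurableI; first exact: measurableC.
exact: measurable_preimage (measurable_run_set N mD).
Qed.

(* The first [N.+1] preimages of the entry set are disjoint, and [iter N.+1 T]
   maps each of them into [D]. *)
Lemma run_entry_measure D N : measurable D ->
  (N.+1%:R%:E * m (run_entry D N) <= m D)%E.
Proof.
move=> mD; rewrite -[leRHS](measure_iter mT Tinv N.+1) //.
have mV := measurable_run_entry N mD.
have mF i := measurable_iter_preimage mT i mV.
have -> : (N.+1%:R%:E * m (run_entry D N) =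
    \sum_(i < N.+1) m (iter i T @^-1` run_entry D N))%E.
  under eq_bigr do rewrite measure_iter //.
  by rewrite sumr_const card_ord mule_natl.
apply: (@sum_measure_disjoint_le _ _ _ m (fun i => iter i T @^-1` run_entry D N)) => //.
- exact: measurable_iter_preimage.
- move=> i j ij jN; apply/seteqP; split => // x [[_ xi] [xj _]].
  apply: xj; have := xi (j - i.+1)%N; rewrite -iterS -iterSr -iterD.
  by rewrite (_ : (j - i.+1).+1 + i = j)%N; [apply; move: jN => /=; lia | lia].
- move=> i iN x [_ /(_ (N - i)%N)]; rewrite -iterS -iterSr -iterD.
  by rewrite (_ : (N - i).+1 + i = N.+1)%N; [apply; lia | lia].
Qed.


Definition entry_cover (D : set X) (s r : nat) : set X :=
  \big[setU/set0]_(i < s) (iter i T @^-1` run_entry D r).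

(** Going back from time [i] as long as the orbit stays in [D], one either arrives at time 0 or
    finds the entry of the run, at a time below [s]. *)
Lemma run_hit_sub D s r i x : (i <= s)%N -> run_set D r (iter i T x) ->
  D x \/ entry_cover D s r x.
Proof.
elim: i => [_ h|i IH si hrun]; first by left; exact: (h 0%N).
have [Di|nDi] := pselect (D (iter i T x)).
  apply: IH => [|k kr]; first exact: ltnW.
  case: k kr => // k kr; rewrite -iterD addSn -addnS iterD.
  exact: hrun (ltnW kr).
right; rewrite /entry_cover -(bigcup_mkord s (fun i => iter i T @^-1` run_entry D r)).
by exists i.
Qed.

(** Boole's inequality over [s] entry times, each of measure at most [m D / r.+1]. The right-hand
    side has the shape required by [epsilon_trick0]. *)
Lemma entry_cover_measure D s r k : measurable D -> (2 ^ k * s <= r)%N ->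
  (m (entry_cover D s r) <= (fine (m D) * 2 / (2 ^ k.+1)%:R)%:E)%E.
Proof.
move=> mD h; have mV := measurable_run_entry r mD.
have := run_entry_measure r mD.
rewrite -(fineK (fin_num_prob m mD)) -(fineK (fin_num_prob m mV)) -EFinM lee_fin => h1.
have h2 : (m (entry_cover D s r) <= (s%:R * fine (m (run_entry D r)))%:E)%E.
  apply: le_trans
    (@Boole_inequality _ _ _ m (fun i => iter i T @^-1` run_entry D r) s _) _ => [i _|].
    exact: measurable_iter_preimage.
  rewrite (eq_bigr (fun=> m (run_entry D r))) => [|i _]; last exact: measure_iter.
  by rewrite sumr_const card_ord EFinM fineK ?fin_num_prob // mule_natl.
apply: (le_trans h2); rewrite lee_fin fineK ?fin_num_prob //.
rewrite expnS natrM invfM mulrA mulfK //.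
rewrite ler_pdivlMr ?ltr0n ?expn_gt0 //.
apply: le_trans h1; rewrite mulrAC ler_wpM2r ?fine_ge0 //.
by rewrite -natrM mulnC ler_nat (leq_trans h).
Qed.

(* A point whose orbit meets, at time [s j], a run of length [r j] either meets
   no run of length [r j.+1] at that time, and the corresponding sets are
   preimages of disjoint subsets of [D]; or it meets a run of length [r j.+1]
   after the much shorter time [s j], which puts it into [D] or into a set of
   small measure. *)
Lemma run_union_measure D (s r : nat -> nat) : measurable D ->
  (forall j, (2 ^ j * s j <= r j.+1)%N) -> (forall j, (r j <= r j.+1)%N) ->
  (m (\bigcup_j iter (s j) T @^-1` run_set D (r j)) <= 4%:E * m D)%E.
Proof.
move=> mD hs hr.
pose Q j := run_set D (r j) `\` run_set D (r j.+1).
have mQ j : measurable (Q j) by apply: measurableD; exact: measurable_run_set.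
have mQ' j : measurable (iter (s j) T @^-1` Q j) by exact: measurable_iter_preimage.
have mW j : measurable (entry_cover D (s j) (r j.+1)).
  apply: bigsetU_measurable => i _; apply: measurable_iter_preimage => //.
  exact: measurable_run_entry.
have mU : measurable (\bigcup_j iter (s j) T @^-1` run_set D (r j)).
  apply: bigcup_measurable => j _; apply: measurable_iter_preimage => //.
  exact: measurable_run_set.
have mUQ : measurable (\bigcup_j iter (s j) T @^-1` Q j) by exact: bigcup_measurable.
have mUW : measurable (\bigcup_j entry_cover D (s j) (r j.+1)) by exact: bigcup_measurable.
apply: (@le_trans _ _ (m (\bigcup_j iter (s j) T @^-1` Q j
    `|` (D `|` \bigcup_j entry_cover D (s j) (r j.+1))))%E).
  apply: le_measure_subset => //.
    by apply: measurableU => //; exact: measurableU.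
  move=> x [j _ /= hx].
  have [hx'|hx'] := pselect (run_set D (r j.+1) (iter (s j) T x)).
    have [|] := run_hit_sub (leqnn (s j)) hx'; first by right; left.
    by right; right; exists j.
  by left; exists j.
have D0 : 0 <= fine (m D) by rewrite fine_ge0.
have h1 : (m (\bigcup_j iter (s j) T @^-1` Q j) <= m D)%E.
  apply: (le_trans (generalized_Boole_inequality _ mQ' mUQ)).
  rewrite (eq_eseriesr (fun j _ => measure_iter mT Tinv (s j) (mQ j))).
  apply: series_measure_disjoint_le => //.
    apply: ltn_trivIset => i j ij; apply/seteqP; split => // x [[_ h2] [h3 _]].
    apply: h2; apply: run_set_sub h3.
    by apply: (homo_leq leqnn leq_trans) ij; exact: hr.
  by move=> i x [h _]; exact: (h 0%N).
have h2 : (m (\bigcup_j entry_cover D (s j) (r j.+1)) <= (fine (m D) * 2)%:E)%E.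
  apply: (le_trans (generalized_Boole_inequality _ mW mUW)).
  apply: (le_trans _ (epsilon_trick0 xpredT (mulr_ge0 D0 (ler0n R 2)))).
  by apply: lee_nneseries => // j _; exact: entry_cover_measure.
have h3 : (m (D `|` \bigcup_j entry_cover D (s j) (r j.+1))
    <= m D + (fine (m D) * 2)%:E)%E.
  exact: le_trans (measureU2 m mD mUW) (leeD (lexx _) h2).
(* The constant 4 consists of 1 for the sets [Q j], 1 for [D] and 2 for the entry covers. *)
apply: (@le_trans _ _ (m D + (m D + (fine (m D) * 2)%:E))%E).
  apply: (le_trans (measureU2 m mUQ _)); first exact: measurableU.
  exact: leeD h1 h3.
have [a ->] : exists a, m D = a%:E by exists (fine (m D)); rewrite fineK // fin_num_prob.
by rewrite /= -!EFinD -EFinM lee_fin; lra.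
Qed.

End WeakType.

(** * Birkhoff's theorem for bounded functions *)

Section LimSup.
Variable R : realType.
Variables (u : nat -> R) (C : R).
Hypothesis uC : forall n, `|u n| <= C.

Let u_ub : has_ubound (range u).
Proof. by exists C => _ [n _ <-]; exact: le_trans (ler_norm _) (uC n). Qed.

Let u_lb : has_lbound (range u).
Proof. by exists (- C) => _ [n _ <-]; have := uC n; rewrite ler_norml => /andP[]. Qed.

Let cvg_sups : sups u @ \oo --> limn_sup u.
Proof.
by apply/cvg_ex; exists (inf (range (sups u))); exact: cvg_sups_inf.
Qed.

Lemma limn_sup_upper eps : 0 < eps ->
  exists N, forall n, (N <= n)%N -> u n <= limn_sup u + eps.
Proof.
move=> eps0; have /cvgrPdist_lt /(_ _ eps0)[N _ hN] := cvg_sups.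
exists N => n Nn; have := hN N (leqnn N) => /=; rewrite ltr_distlC => /andP[_ /ltW].
by apply: le_trans; apply: ub_le_sup; [exact: has_ubound_sdrop|exists n].
Qed.

Lemma limn_sup_lower eps N : 0 < eps ->
  exists2 n, (N <= n)%N & limn_sup u - eps < u n.
Proof.
move=> eps0; have h : limn_sup u - eps < sups u N.
  apply: (@lt_le_trans _ _ (limn_sup u)); first by rewrite ltrBlDr ltrDl.
  by apply: nonincreasing_cvgn_ge; [exact: nonincreasing_sups|apply/cvg_ex; exists (limn_sup u)].
have ne : sdrop u N !=set0 by exists (u N); exists N => //=.
by have [_ [n /= Nn <-] hn] := sup_gt ne h; exists n.
Qed.

Lemma limn_sup_norm_le : `|limn_sup u| <= C.
Proof.
rewrite ler_norml; apply/andP; split; apply/ler_addgt0Pr => eps eps0.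
  have [N hN] := limn_sup_upper eps0.
  apply: le_trans (hN N (leqnn N)); have := uC N; rewrite ler_norml => /andP[] //.
have [n _ hn] := limn_sup_lower 0 eps0.
by rewrite -lerBlDr (le_trans (ltW hn)) // (le_trans (ler_norm _)).
Qed.

End LimSup.

Lemma limn_sup_le_shift (R : realType) (u v : nat -> R) (C : R) :
  (forall n, `|u n| <= C) -> (forall n, `|v n| <= C) ->
  (forall eps, 0 < eps -> exists N, forall n, (N <= n)%N -> u n <= v n + eps) ->
  limn_sup u <= limn_sup v.
Proof.
move=> uC vC uv; apply/ler_addgt0Pr => eps eps0.
have e3 : 0 < eps / 3 by lra.
have [N1 h1] := uv _ e3; have [N2 h2] := limn_sup_upper vC e3.
have [n nN h3] := limn_sup_lower uC (maxn N1 N2) e3.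
have := h1 n; have := h2 n.
rewrite (leq_trans (leq_maxl _ _) nN) (leq_trans (leq_maxr _ _) nN).
by move=> /(_ isT) ? /(_ isT) ?; lra.
Qed.

Lemma cvge0_exists_le (R : realType) (u : nat -> \bar R) (eps : R) :
  u n @[n --> \oo] --> 0%E -> 0 < eps -> exists n, (u n <= eps%:E)%E.
Proof.
move=> cu eps0; apply: contrapT => /forallNP h.
have : (eps%:E <= 0)%E.
  by apply: (cvge_ge _ cu); apply: nearW => n; rewrite ltW // ltNge; exact/negP.
by rewrite lee_fin leNgt eps0.
Qed.

Section Birkhoff.
Context (R : realType) (d : measure_display) (X : measurableType d).
Variables (m : probability X R) (T : X -> X).
Hypothesis mT : measurable_fun setT T.
Hypothesis Tinv : forall A : set X, measurable A -> m (T @^-1` A) = m A.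

Definition birkhoff_avg (f : X -> R) n x : R := n.+1%:R^-1 * birkhoff_sum T f n.+1 x.

Lemma measurable_birkhoff_avg f n : measurable_fun setT f ->
  measurable_fun setT (birkhoff_avg f n).
Proof. by move=> mf; apply: measurable_funM => //; exact: measurable_birkhoff_sum. Qed.

Lemma birkhoff_avg_norm_le f C n x : (forall y, `|f y| <= C) ->
  `|birkhoff_avg f n x| <= C.
Proof.
move=> fC; rewrite normrM ger0_norm ?invr_ge0 // ler_pdivrMl ?ltr0n //.
rewrite (le_trans (ler_norm_sum _ _ _)) //.
by rewrite (le_trans (ler_sum _ (fun i _ => fC _))) // sumr_const card_ord mulr_natl.
Qed.

Lemma birkhoff_avg_shift f C x : (forall y, `|f y| <= C) -> forall eps, 0 < eps ->
  exists N, forall n, (N <= n)%N -> `|birkhoff_avg f n (T x) - birkhoff_avg f n x| <= eps.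
Proof.
move=> fC eps eps0; exists (Num.bound (2 * C / eps)) => n Nn.
have C0 : 0 <= C by exact: le_trans (fC x).
have E : birkhoff_sum T f n.+1 (T x) - birkhoff_sum T f n.+1 x = f (iter n.+1 T x) - f x.
  have := birkhoff_sumS T f n.+1 x; rewrite /birkhoff_sum big_ord_recr /= => h; lra.
rewrite /birkhoff_avg -mulrBr E normrM ger0_norm ?invr_ge0 // ler_pdivrMl ?ltr0n //.
apply: (@le_trans _ _ (2 * C)).
  rewrite (le_trans (ler_normB _ _)) // mulr_natl mulr2n lerD //.
rewrite -ler_pdivrMr //; apply: (@le_trans _ _ (Num.bound (2 * C / eps))%:R).
  by apply: ltW; rewrite archi_boundP // divr_ge0 ?mulr_ge0 // ltW.
by rewrite ler_nat (leq_trans Nn).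
Qed.

Definition birkhoff_limsup (f : X -> R) (x : X) : R := limn_sup (birkhoff_avg f ^~ x).

Variables (f : X -> R) (C : R).
Hypothesis mf : measurable_fun setT f.
Hypothesis fC : forall y, `|f y| <= C.

Lemma birkhoff_limsup_norm_le x : `|birkhoff_limsup f x| <= C.
Proof. by apply: limn_sup_norm_le => n; exact: birkhoff_avg_norm_le. Qed.

Lemma birkhoff_limsup_upper x eps : 0 < eps -> exists N, forall n, (N <= n)%N ->
  birkhoff_avg f n x <= birkhoff_limsup f x + eps.
Proof. by apply: limn_sup_upper => n; exact: birkhoff_avg_norm_le. Qed.

Lemma birkhoff_limsup_lower x eps N : 0 < eps -> exists2 n, (N <= n)%N &
  birkhoff_limsup f x - eps < birkhoff_avg f n x.
Proof. by apply: limn_sup_lower => n; exact: birkhoff_avg_norm_le. Qed.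

Lemma measurable_birkhoff_limsup : measurable_fun setT (birkhoff_limsup f).
Proof.
apply: measurable_fun_limn_sup => [x _|x _|n]; last exact: measurable_birkhoff_avg.
  by exists C => _ [n _ <-]; rewrite (le_trans (ler_norm _)) // birkhoff_avg_norm_le.
exists (- C) => _ [n _ <-].
by have := birkhoff_avg_norm_le n x fC; rewrite ler_norml => /andP[].
Qed.

Lemma birkhoff_limsup_invariant x : birkhoff_limsup f (T x) = birkhoff_limsup f x.
Proof.
have bd y n := birkhoff_avg_norm_le n y fC.
apply/eqP; rewrite eq_le; apply/andP; split;
  apply: (limn_sup_le_shift (bd _) (bd _)) => eps eps0;
  have [N hN] := birkhoff_avg_shift x fC eps0; exists N => n /hN;
  rewrite ler_distl => /andP[]; lra.
Qed.

Lemma integrable_bounded (g : X -> R) (K : R) : measurable_fun setT g ->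
  (forall x, `|g x| <= K) -> m.-integrable setT (EFin \o g).
Proof.
move=> mg gK; apply: measurable_bounded_integrable => //.
  by rewrite -ge0_fin_numE // fin_num_prob.
exact: norm_le_bounded gK.
Qed.

(* The maximal ergodic theorem applied to [f - birkhoff_limsup f + eps], some
   Birkhoff sum of which is positive at every point. *)
Lemma integral_birkhoff_limsup :
  (\int[m]_x (birkhoff_limsup f x)%:E <= \int[m]_x (f x)%:E)%E.
Proof.
pose fb := birkhoff_limsup f.
have fi := integrable_bounded mf fC.
have fbi := integrable_bounded measurable_birkhoff_limsup birkhoff_limsup_norm_le.
apply/lee_addgt0Pr => eps eps0.
pose h x := f x - fb x + eps.
pose D n := [set x | 0 < birkhoff_max T h n.+1 x].
have mh : measurable_fun setT h.
  apply: measurable_funD => //; apply: measurable_funB => //.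
  exact: measurable_birkhoff_limsup.
have hC x : `|h x| <= C + C + eps.
  rewrite (le_trans (ler_normD _ _)) // (gtr0_norm eps0) lerD2r.
  by rewrite (le_trans (ler_normB _ _)) // lerD // birkhoff_limsup_norm_le.
have hi := integrable_bounded mh hC.
have mD n : measurable (D n).
  have /integrableP[/measurable_EFinP mM _] := integrable_birkhoff_max mT Tinv n.+1 hi.
  exact: measurable_gt.
have fbT i x : fb (iter i T x) = fb x.
  by elim: i => //= i IH; rewrite /fb birkhoff_limsup_invariant.
have hD x : exists N, forall n, (N <= n)%N -> D n x.
  have [N _ hN] := birkhoff_limsup_lower x 0 eps0.
  exists N => n Nn; change (0 < birkhoff_max T h n.+1 x).
  have : 0 < birkhoff_max T h N.+1 x.
    apply: lt_le_trans (birkhoff_sum_le_max _ _ _ _).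
    rewrite /birkhoff_sum (eq_bigr (fun i : 'I_N.+1 => f (iter i T x) - (fb x - eps))).
      rewrite sumrB sumr_const card_ord subr_gt0 -mulr_natl -ltr_pdivlMl ?ltr0n //.
    by move=> i _; rewrite /h fbT; lra.
  move=> /lt_le_trans; apply.
  by apply: birkhoff_max_le; rewrite ltnS.
have mhD n : measurable_fun setT (fun x => (h x * \1_(D n) x)%:E).
  by apply/measurable_EFinP; apply: measurable_funM => //; exact: measurable_indic.
(* Every point lies in [D n] for all large [n], so the maximal inequality over [D n] passes to the
   integral of [h] over the whole space. *)
have [_ _ cv] : [/\ m.-integrable setT (EFin \o h),
    (\int[m]_x `|(h x * \1_(D n) x)%:E - (h x)%:E|)%E @[n --> \oo] --> 0%E &
    (\int[m]_x (h x * \1_(D n) x)%:E)%E @[n --> \oo] --> (\int[m]_x (h x)%:E)%E].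
  apply: (@dominated_convergence _ X R m setT measurableT
    (fun n x => (h x * \1_(D n) x)%:E) (EFin \o h) (cst (C + C + eps)%:E)) => //.
  - exact/measurable_EFinP.
  - apply: aeW => x _; have [N hN] := hD x.
    apply: (@cvg_trans _ (cst (h x)%:E @ \oo)); last exact: cvg_cst.
    apply: near_eq_cvg; exists N => // n /= Nn.
    by rewrite indicE mem_set ?mulr1 //; exact: hN.
  - exact: finite_measure_integrable_cst.
  - apply: aeW => x n _ /=; rewrite lee_fin normrM (le_trans _ (hC x)) //.
    by rewrite ler_piMr // indicE normr_nat lern1 leq_b1.
have h0 : (0 <= \int[m]_x (h x)%:E)%E.
  rewrite -(cvg_lim _ cv) //; apply: lime_ge; first by apply/cvg_ex; eexists; exact: cv.
  by apply: nearW => n; exact: maximal_ergodic.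
have hE : (\int[m]_x (h x)%:E =
    \int[m]_x (f x)%:E - \int[m]_x (fb x)%:E + eps%:E)%E.
  rewrite -integralB //.
  rewrite -[X in (_ + X)%E]mule1 -[X in (_ + _ * X)%E](@probability_setT _ _ _ m).
  rewrite -(@integral_cst _ _ _ m setT measurableT) -integralD //.
    exact: integrableB.
  exact: finite_measure_integrable_cst.
move: h0; rewrite hE.
have [a ->] : exists a, (\int[m]_x (f x)%:E)%E = a%:E.
  by exists (fine (\int[m]_x (f x)%:E)); rewrite fineK //; exact: integrable_fin_num.
have [b ->] : exists b, (\int[m]_x (fb x)%:E)%E = b%:E.
  by exists (fine (\int[m]_x (fb x)%:E)); rewrite fineK //; exact: integrable_fin_num.
rewrite -EFinB -!EFinD !lee_fin; lra.
Qed.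

End Birkhoff.

Section BirkhoffConvergence.
Context (R : realType) (d : measure_display) (X : measurableType d).
Variables (m : probability X R) (T : X -> X).
Hypothesis mT : measurable_fun setT T.
Hypothesis Tinv : forall A : set X, measurable A -> m (T @^-1` A) = m A.
Variables (f : X -> R) (C : R).
Hypothesis mf : measurable_fun setT f.
Hypothesis fC : forall y, `|f y| <= C.

Let f' := fun y => - f y.

Let mf' : measurable_fun setT f'.
Proof. exact: measurableT_comp. Qed.

Let f'C y : `|f' y| <= C.
Proof. by rewrite normrN. Qed.

Let avgN n x : birkhoff_avg T f' n x = - birkhoff_avg T f n x.
Proof. by rewrite /birkhoff_avg /birkhoff_sum sumrN mulrN. Qed.

Let limsupD_ge0 x : 0 <= birkhoff_limsup T f x + birkhoff_limsup T f' x.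
Proof.
suff h (eps : R) : 0 < eps -> 0 <= birkhoff_limsup T f x + birkhoff_limsup T f' x + eps.
  exact/ler_addgt0Pr.
move=> eps0; have e2 : 0 < eps / 2 by lra.
have [N hN] := birkhoff_limsup_upper T f'C x e2.
have [N' hN'] := birkhoff_limsup_upper T fC x e2.
have := hN _ (leq_maxl N N'); have := hN' _ (leq_maxr N N'); rewrite avgN; lra.
Qed.

(** As [f'] is [- f], the function [G] is the upper limit minus the lower limit of the averages,
    hence nonnegative; the integral inequality for [f] and for [- f] makes its integral zero. *)
Lemma birkhoff_ae : {ae m, forall x,
  birkhoff_avg T f n x @[n --> \oo] --> birkhoff_limsup T f x}.
Proof.
pose G x := birkhoff_limsup T f x + birkhoff_limsup T f' x.
have l1i := integrable_bounded m (measurable_birkhoff_limsup mT mf fC)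
  (birkhoff_limsup_norm_le T fC).
have l2i := integrable_bounded m (measurable_birkhoff_limsup mT mf' f'C)
  (birkhoff_limsup_norm_le T f'C).
have fi := integrable_bounded m mf fC.
have mG : measurable_fun setT (EFin \o G).
  by apply/measurable_EFinP/measurable_funD; exact: measurable_birkhoff_limsup.
have G0 : (\int[m]_x `|(EFin \o G) x| = 0)%E.
  apply/eqP; rewrite eq_le integral_ge0 // andbT.
  rewrite (eq_integral (fun x => (birkhoff_limsup T f x)%:E
      + (birkhoff_limsup T f' x)%:E)%E); last first.
    by move=> x _ /=; rewrite -EFinD (ger0_norm (limsupD_ge0 x)).
  rewrite integralD //.
  rewrite (le_trans (leeD (integral_birkhoff_limsup mT Tinv mf fC)
    (integral_birkhoff_limsup mT Tinv mf' f'C))) //.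
  rewrite -integralD //; last exact: integrable_bounded f'C.
  by rewrite integral0_eq // => x _; rewrite -EFinD subrr.
have /(ae_eq_integral_abs m measurableT mG) := G0.
apply: filterS => x /(_ I) [Gx].
apply/cvgrPdist_le => eps eps0.
have [N1 h1] := birkhoff_limsup_upper T fC x eps0.
have [N2 h2] := birkhoff_limsup_upper T f'C x eps0.
exists (maxn N1 N2) => // n /= hn.
have := h1 n (leq_trans (leq_maxl _ _) hn); have := h2 n (leq_trans (leq_maxr _ _) hn).
rewrite avgN.
move: Gx; rewrite /G ler_distl => Gx a b; apply/andP; split; lra.
Qed.

Lemma birkhoff_L1 (eta : R) : 0 < eta -> exists n,
  (\int[m]_x (`|birkhoff_avg T f n x - birkhoff_limsup T f x|)%:E <= eta%:E)%E.
Proof.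
move=> eta0.
have [_ cv _] : [/\ m.-integrable setT (EFin \o birkhoff_limsup T f),
    (\int[m]_x `|(birkhoff_avg T f n x)%:E - (birkhoff_limsup T f x)%:E|)%E
       @[n --> \oo] --> 0%E &
    (\int[m]_x (birkhoff_avg T f n x)%:E)%E @[n --> \oo]
       --> (\int[m]_x (birkhoff_limsup T f x)%:E)%E].
  apply: (@dominated_convergence _ X R m setT measurableT
    (fun n x => (birkhoff_avg T f n x)%:E) (EFin \o birkhoff_limsup T f)
    (cst C%:E)) => //.
  - by move=> n; apply/measurable_EFinP; exact: measurable_birkhoff_avg.
  - by apply/measurable_EFinP; exact: measurable_birkhoff_limsup.
  - by apply: filterS birkhoff_ae => x h _; apply/fine_cvgP; split; [exact: nearW|exact: h].
  - exact: finite_measure_integrable_cst.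
  - by apply: aeW => x n _ /=; rewrite lee_fin; exact: birkhoff_avg_norm_le.
exact: cvge0_exists_le cv eta0.
Qed.

End BirkhoffConvergence.

(** * Averages along the intervals *)

Section BlockConvergence.
Context (R : realType) (d : measure_display) (X : measurableType d).
Variables (m : probability X R) (T : X -> X).
Hypothesis mT : measurable_fun setT T.
Hypothesis Tinv : forall A : set X, measurable A -> m (T @^-1` A) = m A.
Variables e n c : nat -> nat.
Hypothesis e_gt0 : forall j, (0 < e j)%N.
Hypothesis n_gt0 : forall j, (0 < n j)%N.

Local Notation base_start := (base_start e n c).
Local Notation base_len := (base_len e n c).
Local Notation stage_pos := (stage_pos e n c).
Local Notation block_seq := (block_seq e n c).
Local Notation is_base := (is_base e n c).

(* If the sum over the first [t] terms of block [j] exceeds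
   [lam * (stage_pos j + t)], then so does the sum extended to the left by at
   most [stage_pos j] terms, so the orbit runs through [excess_set g lam] during
   the [stage_pos j] steps before the block. *)
Lemma excess_run (g : X -> R) (lam : R) j t x : 0 <= lam -> (forall x, 0 <= g x) ->
  lam * (stage_pos j + t)%:R < \sum_(i < t) g (iter (base_start j + i) T x) ->
  run_set T (excess_set T g lam) (stage_pos j) (iter (base_start j - stage_pos j) T x).
Proof.
move=> lam0 g0 h i ij; exists ((stage_pos j - i) + t)%N.
have hpos := @stage_pos_le e n c n_gt0 j.
rewrite /birkhoff_sum big_split_ord /=.
apply: (@le_lt_trans _ _ (lam * (stage_pos j + t)%:R)).
  by rewrite ler_wpM2l // ler_nat leq_add2r leq_subr.
apply: (lt_le_trans h); rewrite -[leLHS]add0r lerD ?sumr_ge0 //.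
apply: ler_sum => k _; rewrite -!iterD.
rewrite (_ : base_start j + k = stage_pos j - i + k + i + (base_start j - stage_pos j))%N //.
by move: hpos ij; lia.
Qed.

(** If the bound fails at [x], the orbit runs through the excess set just before some base block.
    [run_union_measure] bounds the set of such points; its growth condition follows from
    [2 ^ j * base_start j <= stage_pos j.+1]. *)
Lemma block_maximal (g : X -> R) (lam : R) : 0 < lam -> (forall x, 0 <= g x) ->
  m.-integrable setT (EFin \o g) ->
  exists A : set X, [/\ measurable A,
    (m A <= (4 / lam)%:E * \int[m]_x (g x)%:E)%E &
    forall x, ~ A x -> forall N,
      \sum_(t < N | is_base t) g (iter (block_seq t) T x) <= 3 * lam * N%:R].
Proof.
move=> lam0 g0 gi; have /integrableP[/measurable_EFinP mg _] := gi.
pose s j := (base_start j - stage_pos j)%N.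
have mD := measurable_excess_set mT lam mg.
exists (\bigcup_j iter (s j) T @^-1` run_set T (excess_set T g lam) (stage_pos j)).
split.
- apply: bigcup_measurable => j _; apply: measurable_iter_preimage => //.
  exact: measurable_run_set.
- apply: le_trans (run_union_measure mT Tinv mD _ _) _.
  + move=> j; apply: leq_trans (stage_pos_ge e n c j).
    by rewrite leq_mul2l leq_subr orbT.
  + by move=> j; exact: stage_pos_homo.
  rewrite EFinM -muleA; apply: lee_wpmul2l => //.
  exact: excess_set_measure.
move=> x xA N; apply: (base_sum_le e_gt0 n_gt0 (F := fun s => g (iter s T x))).
  exact: ltW.
move=> j t _; rewrite leNgt; apply/negP => /(excess_run (ltW lam0) g0) h.
by apply: xA; exists j.
Qed.

Definition trunc_fun (f : X -> R) (K : R) (x : X) : R :=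
  f x * \1_[set y | `|f y| <= K] x.

Lemma measurable_trunc_fun f K : measurable_fun setT f ->
  measurable_fun setT (trunc_fun f K).
Proof.
move=> mf; apply: measurable_funM => //; apply: measurable_indic.
have -> : [set y | `|f y| <= K] = ~` [set y | K < `|f y|].
  by apply/seteqP; split => y /=; rewrite leNgt => /negP.
by apply/measurableC/measurable_gt; exact: measurableT_comp.
Qed.

Lemma trunc_fun_norm_le f K x : 0 <= K -> `|trunc_fun f K x| <= K.
Proof.
move=> K0; rewrite /trunc_fun indicE; case: (boolP (x \in _)).
  by rewrite inE /= mulr1.
by rewrite mulr0 normr0.
Qed.

Lemma trunc_fun_L1 f (eta : R) : m.-integrable setT (EFin \o f) -> 0 < eta ->
  exists k : nat, (\int[m]_x (`|f x - trunc_fun f k%:R x|)%:E <= eta%:E)%E.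
Proof.
move=> fi eta0; have /integrableP[/measurable_EFinP mf _] := fi.
have [_ cv _] : [/\ m.-integrable setT (EFin \o f),
    (\int[m]_x `|(trunc_fun f k%:R x)%:E - (f x)%:E|)%E @[k --> \oo] --> 0%E &
    (\int[m]_x (trunc_fun f k%:R x)%:E)%E @[k --> \oo] --> (\int[m]_x (f x)%:E)%E].
  apply: (@dominated_convergence _ X R m setT measurableT
    (fun k x => (trunc_fun f k%:R x)%:E) (EFin \o f) (fun x => `|f x|%:E)) => //.
  - by move=> k; apply/measurable_EFinP; exact: measurable_trunc_fun.
  - exact/measurable_EFinP.
  - apply: aeW => x _; apply: (@cvg_trans _ (cst (f x)%:E @ \oo)); last exact: cvg_cst.
    apply: near_eq_cvg; exists (Num.bound `|f x|) => // k /= hk.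
    rewrite /trunc_fun indicE mem_set ?mulr1 //=.
    by rewrite (le_trans (ltW (archi_boundP _))) // ler_nat.
  - exact: integrable_norm.
  - apply: aeW => x k _ /=; rewrite lee_fin /trunc_fun normrM.
    by rewrite ler_piMr // indicE normr_nat lern1 leq_b1.
have [k hk] := cvge0_exists_le cv eta0; exists k.
by under eq_integral do rewrite distrC.
Qed.

(** Let [fc] be a truncation of [f] and [fs] the upper limit of its averages. Both [f - fc] and the
    difference between a long average of [fc] and [fs] are small in L1, hence controlled by
    [block_maximal] outside a small set; the difference between [fc] and that average is controlled
    everywhere by [base_sum_shift]. The constant [l] is [fs x]. *)
Lemma base_sum_near (f : X -> R) (lam eta : R) : 0 < lam -> 0 < eta ->
  m.-integrable setT (EFin \o f) ->
  exists A : set X, [/\ measurable A, (m A <= eta%:E)%E &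
    forall x, ~ A x -> exists l D : R, 0 <= D /\ forall N,
      `|\sum_(t < N | is_base t) (f (iter (block_seq t) T x) - l)|
      <= D + lam * N%:R].
Proof.
move=> lam0 eta0 fi; have /integrableP[/measurable_EFinP mf _] := fi.
(* The constants satisfy [3 * lam' = lam / 2] and [4 / lam' * (2 * eta') = eta]. *)
pose lam' := lam / 6; have lam'0 : 0 < lam' by rewrite divr_gt0.
pose eta' := eta * lam' / 8; have eta'0 : 0 < eta' by rewrite divr_gt0 // mulr_gt0.
have [k hk] := trunc_fun_L1 fi eta'0.
pose fc := trunc_fun f k%:R.
have mfc : measurable_fun setT fc by exact: measurable_trunc_fun.
have fcC x : `|fc x| <= k%:R by exact: trunc_fun_norm_le.
have [p hp] := birkhoff_L1 mT Tinv mfc fcC eta'0.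
pose fs := birkhoff_limsup T fc.
have mfs : measurable_fun setT fs by exact: measurable_birkhoff_limsup.
have fci := integrable_bounded m mfc fcC.
have fsi := integrable_bounded m mfs (birkhoff_limsup_norm_le T fcC).
have avi := integrable_bounded m (measurable_birkhoff_avg mT p mfc)
  (fun x => birkhoff_avg_norm_le T p x fcC).
pose g1 x := `|f x - fc x|; pose g2 x := `|birkhoff_avg T fc p x - fs x|.
have g1i : m.-integrable setT (EFin \o g1).
  have := integrable_abse (integrableB measurableT fi fci).
  by apply: eq_integrable.
have g2i : m.-integrable setT (EFin \o g2).
  have := integrable_abse (integrableB measurableT avi fsi).
  by apply: eq_integrable.
have gi : m.-integrable setT (EFin \o (fun x => g1 x + g2 x)).
  by have := integrableD measurableT g1i g2i; apply: eq_integrable.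
have g0 x : 0 <= g1 x + g2 x by rewrite addr_ge0 // normr_ge0.
have [A [mA hA hx]] := block_maximal lam'0 g0 gi.
exists A; split => //.
  apply: (le_trans hA); under eq_integral do rewrite EFinD.
  rewrite integralD //; apply: (@le_trans _ _ ((4 / lam')%:E * (eta'%:E + eta'%:E))%E).
    by apply: lee_wpmul2l; [rewrite lee_fin ltW // divr_gt0|exact: leeD].
  rewrite -EFinD -EFinM lee_fin /eta' le_eqVlt; apply/orP; left; apply/eqP.
  by field; rewrite gt_eqF.
move=> x /hx {}hx.
have fsT i : fs (iter i T x) = fs x.
  by elim: i => //= i IH; rewrite /fs (birkhoff_limsup_invariant T fcC).
have lam2 : 0 < lam / 2 by rewrite divr_gt0.
have [D D0 hD] := @base_sum_shift R e n c e_gt0 n_gt0 (fun s => fc (iter s T x))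
  k%:R p.+1 isT (fun i => fcC _) _ lam2.
exists (fs x), D; split => // N.
pose a t := block_seq t.
have -> : \sum_(t < N | is_base t) (f (iter (a t) T x) - fs x) =
  \sum_(t < N | is_base t) (f (iter (a t) T x) - fc (iter (a t) T x)
       + (birkhoff_avg T fc p (iter (a t) T x) - fs (iter (a t) T x)))
  + \sum_(t < N | is_base t) (fc (iter (a t) T x)
        - p.+1%:R^-1 * \sum_(r < p.+1) fc (iter (a t + r) T x)).
  have avE t : birkhoff_avg T fc p (iter (a t) T x) =
      p.+1%:R^-1 * \sum_(r < p.+1) fc (iter (a t + r) T x).
    by congr (_ * _); apply: eq_bigr => r _; rewrite -iterD addnC.
  by rewrite -big_split /=; apply: eq_bigr => t _; rewrite fsT avE; ring.
rewrite (le_trans (ler_normD _ _)) // [leLHS]addrC.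
have -> : D + lam * N%:R = D + lam / 2 * N%:R + 3 * lam' * N%:R by rewrite /lam'; field.
apply: lerD; first exact: hD.
apply: le_trans (hx N); rewrite (le_trans (ler_norm_sum _ _ _)) //.
by apply: ler_sum => t _; rewrite (le_trans (ler_normD _ _)).
Qed.

End BlockConvergence.

(** * The perturbation blocks *)

(** The constant [l] may depend on [lam]: the Cauchy criterion asks only that, for each [eps], the
    averages eventually stay within [eps] of some number. The third condition gives the times
    outside [B] density zero, so that [l] may be subtracted at the times in [B] only. *)
Lemma cvg_block_average (R : realType) (B : pred nat) (F : nat -> R) :
  (forall lam, 0 < lam -> exists l D : R, 0 <= D /\ forall N,
     `|\sum_(t < N | B t) (F t - l)| <= D + lam * N%:R) ->
  (forall lam, 0 < lam -> exists2 D : R, 0 <= D & forall N,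
     \sum_(t < N | ~~ B t) `|F t| <= D + lam * N%:R) ->
  (forall lam, 0 < lam -> exists2 D : R, 0 <= D & forall N,
     \sum_(t < N | ~~ B t) 1 <= D + lam * N%:R) ->
  cvgn (fun N => N.+1%:R^-1 * \sum_(t < N.+1) F t).
Proof.
move=> hbase hpert hpert1; apply: cauchy_cvg; apply: cauchy_exP => eps eps0.
have [lam lam0 epsE] : exists2 lam, 0 < lam & eps = 5 * lam.
  by exists (eps / 5); [lra|field].
have [l [D1 [D10 h1]]] := hbase _ lam0.
have [D2 D20 h2] := hpert _ lam0.
have l1 : 0 < `|l| + 1 by rewrite ltr_wpDl.
have [D3 D30 h3] := hpert1 (lam / (`|l| + 1)) (divr_gt0 lam0 l1).
pose D := D1 + D2 + `|l| * D3.
have D0 : 0 <= D by rewrite !addr_ge0 // mulr_ge0.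
have hN N : `|\sum_(t < N) F t - l * N%:R| <= D + 3 * lam * N%:R.
  have -> : \sum_(t < N) F t - l * N%:R = \sum_(t < N | B t) (F t - l)
      + (\sum_(t < N | ~~ B t) F t - l * \sum_(t < N | ~~ B t) 1).
    have -> : l * N%:R = \sum_(t < N) l by rewrite sumr_const card_ord mulr_natr.
    rewrite mulr_sumr -!sumrB.
    rewrite (bigID (fun t : 'I_N => B t)) /=; congr (_ + _).
    by apply: eq_bigr => t _; rewrite mulr1.
  have -> : D + 3 * lam * N%:R = (D1 + lam * N%:R) + ((D2 + lam * N%:R)
      + (`|l| * D3 + lam * N%:R)) by rewrite /D; ring.
  rewrite (le_trans (ler_normD _ _)) // lerD // (le_trans (ler_normB _ _)) // lerD //.
    by rewrite (le_trans (ler_norm_sum _ _ _)).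
  have s0 : 0 <= \sum_(t < N | ~~ B t) 1 :> R by rewrite sumr_ge0.
  rewrite normrM (ger0_norm s0) (le_trans (ler_wpM2l _ (h3 N))) //.
  rewrite mulrDr lerD2l !mulrA ler_wpM2r //.
  rewrite ler_pdivrMr // mulrC ler_wpM2l ?(ltW lam0) //.
  by rewrite lerDl.
exists l; exists (Num.bound (D / lam)) => // N /= hNb.
have DN : D < lam * N.+1%:R.
  rewrite mulrC -ltr_pdivrMr // (lt_le_trans (archi_boundP _)) ?divr_ge0 // ?ltW //.
  by rewrite ltr_nat ltnS.
have N0 : 0 < N.+1%:R :> R by rewrite ltr0n.
rewrite /ball /= -(ltr_pM2r N0) -[X in `|_| * X](gtr0_norm N0) -normrM.
rewrite mulrBl mulrAC mulVf ?gt_eqF // mul1r distrC.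
apply: (le_lt_trans (hN _)).
rewrite epsE.
nra.
Qed.

Lemma nneseries_lty_eventually (R : realType) (a : nat -> R) :
  (forall j, 0 <= a j) -> (\sum_(j <oo) (a j)%:E < +oo)%E ->
  forall eps, 0 < eps -> exists J, forall j, (J <= j)%N -> a j <= eps.
Proof.
move=> a0 afin eps eps0.
have /cvg_series_cvg_0 : cvgn (series a).
  apply: nondecreasing_is_cvgn; first exact: nondecreasing_series.
  exists (fine (\sum_(j <oo) (a j)%:E)%E) => _ [n _ <-].
  rewrite -lee_fin fineK; last first.
    by rewrite ge0_fin_numE // nneseries_ge0 // => j _ _; rewrite lee_fin.
  rewrite /series /= -sumEFin.
  by apply: nneseries_lim_ge => j _; rewrite lee_fin.
move=> /cvgrPdist_le /(_ _ eps0)[J _ hJ]; exists J => j /hJ /=.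
by rewrite sub0r normrN ger0_norm.
Qed.

Section StageParameters.
Variables u nk : nat -> nat.

(** Level [k] comprises [nk k] consecutive stages, one for each residue modulo [nk k]. *)
Definition level (j : nat) : nat := (lex nk j).1.
Definition residue (j : nat) : nat := (lex nk j).2.
Definition level_ratio (j : nat) : nat := (2 ^ level j * u (level j))%N.
Definition level_step (j : nat) : nat := nk (level j).

Definition perturbed_seq : nat -> nat := block_seq level_ratio level_step residue.

End StageParameters.

Section PerturbationDecay.
Context (R : realType) (d : measure_display) (X : measurableType d).
Variables (m : probability X R) (T : X -> X).
Hypothesis mT : measurable_fun setT T.
Hypothesis Tinv : forall A : set X, measurable A -> m (T @^-1` A) = m A.
Variable phi : R -> R.
Hypothesis phi_ndecr : {homo phi : x y / x <= y}.
Hypothesis phi_ge1 : forall x, 1 <= phi x.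
Variables u nk : nat -> nat.
Hypothesis u_gt0 : forall k, (0 < u k)%N.
Hypothesis nk_gt0 : forall k, (0 < nk k)%N.
Hypothesis nk_le : forall k, (nk k)%:R <= phi (u k)%:R * (u k)%:R.

Local Notation e := (level_ratio u nk).
Local Notation n := (level_step nk).
Local Notation c := (residue nk).
Local Notation base_len := (base_len e n c).
Local Notation pert_start := (pert_start e n c).
Local Notation pert_len := (pert_len e n c).

Lemma level_ratio_gt0 j : (0 < e j)%N.
Proof. by rewrite muln_gt0 expn_gt0 u_gt0. Qed.

Lemma level_step_gt0 j : (0 < n j)%N.
Proof. exact: nk_gt0. Qed.

Variable f : X -> R.
Hypothesis f_phi : Lclass phi m f.

Let mf : measurable_fun setT f. Proof. by case: f_phi. Qed.

Let phi_ge0 x : 0 <= phi x.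
Proof. exact: le_trans (phi_ge1 x). Qed.

Let mphif : measurable_fun setT (fun x => (`|f x| * phi `|f x|)%:E).
Proof.
apply/measurable_EFinP; apply: measurable_funM; first exact: measurableT_comp.
have mphi : measurable_fun setT phi by exact: nondecreasing_measurable.
exact: (measurableT_comp mphi (measurableT_comp (@normr_measurable R setT) mf)).
Qed.

Lemma Lclass_integrable : m.-integrable setT (EFin \o f).
Proof.
have [_ hf] := f_phi; apply/integrableP; split; first exact/measurable_EFinP.
apply: le_lt_trans hf; apply: ge0_le_integral => //.
  by apply: measurableT_comp => //; exact/measurable_EFinP.
by move=> x _ /=; rewrite lee_fin ler_peMr.
Qed.

Let tail (k : nat) (x : X) : R := `|f x| * \1_[set y | (u k)%:R < `|f y|] x.

Let tail_ge0 k x : 0 <= tail k x.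
Proof. by rewrite mulr_ge0. Qed.

Let mtail k : measurable_fun setT (tail k).
Proof.
apply: measurable_funM; first exact: measurableT_comp.
by apply/measurable_indic/measurable_gt; exact: measurableT_comp.
Qed.

Let fE k x : `|f x| <= (u k)%:R + tail k x.
Proof.
rewrite /tail indicE; case: (boolP (x \in _)) => /=.
  by rewrite mulr1 lerDr.
by rewrite notin_setE /= mulr0 addr0 => /negP; rewrite -leNgt.
Qed.

Let K := fine (\int[m]_x (`|f x| * phi `|f x|)%:E)%E.

Let KE : (\int[m]_x (`|f x| * phi `|f x|)%:E)%E = K%:E.
Proof.
have [_ hf] := f_phi; rewrite /K fineK // ge0_fin_numE //.
by apply: integral_ge0 => x _; rewrite lee_fin mulr_ge0.
Qed.

Let K_ge0 : 0 <= K.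
Proof. by rewrite fine_ge0 // integral_ge0 // => x _; rewrite lee_fin mulr_ge0. Qed.

(** Where the absolute value of [f] exceeds [u k], its image under [phi] is at least [phi (u k)]. *)
Let tail_integral k : (\int[m]_x (tail k x)%:E <= (K / phi (u k)%:R)%:E)%E.
Proof.
have phi0 : 0 < phi (u k)%:R by exact: lt_le_trans (phi_ge1 _).
rewrite mulrC EFinM lee_pdivlMl // -KE -ge0_integralZl //; last 3 first.
- exact/measurable_EFinP.
- by move=> x _; rewrite lee_fin.
- by rewrite lee_fin.
apply: ge0_le_integral => //.
- by move=> x _; rewrite mule_ge0 // lee_fin.
- by apply/measurable_EFinP; apply: measurable_funM.
move=> x _; rewrite -EFinM lee_fin /tail indicE; case: (boolP (x \in _)) => /=.
  rewrite inE /= => h; rewrite mulr1 mulrC ler_wpM2l // phi_ndecr // ltW //.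
by rewrite !mulr0 mulr_ge0.
Qed.

Let excess (j : nat) (x : X) : R := (base_len j)%:R^-1 *
  \sum_(i < pert_len j) tail (level nk j) (iter (pert_start j + n j * i)%N T x).

Let excess_ge0 j x : 0 <= excess j x.
Proof. by rewrite mulr_ge0 ?invr_ge0 // sumr_ge0. Qed.

Let mexcess j : measurable_fun setT (excess j).
Proof.
apply: measurable_funM => //; apply: measurable_sum => i.
exact: measurable_comp_iter.
Qed.

Let bound (k : nat) : R := K / (phi (u k)%:R * (2 ^ k * u k)%:R).

Let bound_ge0 k : 0 <= bound k.
Proof. by rewrite divr_ge0 // mulr_ge0. Qed.

Let excess_integral j : (\int[m]_x (excess j x)%:E <= (bound (level nk j))%:E)%E.
Proof.
pose p := pert_len j; set k := level nk j.
have p0 : 0 < p%:R :> R by rewrite ltr0n; exact: pert_len_gt0 level_step_gt0 j.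
have e0 : 0 < (e j)%:R :> R by rewrite ltr0n; exact: level_ratio_gt0.
have mti i : measurable_fun setT (fun x => (tail k (iter i T x))%:E).
  by apply/measurable_EFinP; exact: measurable_comp_iter.
under eq_integral do rewrite EFinM -sumEFin.
rewrite ge0_integralZl //; last 2 first.
- by apply: emeasurable_sum => i; exact (mti (pert_start j + n j * i)%N).
- by move=> x _; rewrite sume_ge0 // => i _; rewrite lee_fin.
rewrite ge0_integral_sum //; last by move=> i x _; rewrite lee_fin.
rewrite (eq_bigr (fun=> \int[m]_x (tail k x)%:E)%E); last first.
  move=> i _; rewrite (@ge0_integral_iter _ _ _ m T mT Tinv _ (fun x => (tail k x)%:E)) //.
    exact/measurable_EFinP.
  by move=> x; rewrite lee_fin.
have -> : (\sum_(i < pert_len j) \int[m]_x (tail k x)%:E =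
    (pert_len j)%:R%:E * \int[m]_x (tail k x)%:E)%E.
  by rewrite sumr_const card_ord mule_natl.
rewrite muleA -EFinM.
have -> : (base_len j)%:R^-1 * (pert_len j)%:R = (e j)%:R^-1 :> R.
  by rewrite base_lenE natrM -/p; field; rewrite !gt_eqF.
apply: (@le_trans _ _ ((e j)%:R^-1%:E * (K / phi (u k)%:R)%:E)%E).
  by apply: lee_wpmul2l => //; rewrite lee_fin invr_ge0.
by rewrite -EFinM lee_fin /bound invfM mulrCA (mulrC (_^-1)).
Qed.

(** The sum is first extended to whole levels. Level [k] has [nk k <= phi (u k) * u k] stages with
    the same bound, so it contributes at most [K / 2 ^ k]. *)
Let sum_bound N : \sum_(j < N) bound (level nk j) <= 2 * K.
Proof.
apply: (@le_trans _ _ (\sum_(j < lex_start nk N) bound (level nk j))).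
  rewrite -!(big_mkord xpredT (fun j => bound (level nk j))).
  rewrite [leRHS](@big_cat_nat _ _ _ N) ?lex_start_ge //= lerDl.
  exact: sumr_ge0.
have := @big_lex nk nk_gt0 R (fun k _ => bound k) N 0 (leq0n _).
rewrite addn0 big_ord0 addr0 => ->.
apply: (@le_trans _ _ (\sum_(k < N) K * (2 ^ k)%:R^-1)).
  apply: ler_sum => k _; rewrite sumr_const card_ord.
  have phi0 : 0 < phi (u k)%:R by exact: lt_le_trans (phi_ge1 _).
  have u0 : 0 < (u k)%:R :> R by rewrite ltr0n.
  have p0 : 0 < (2 ^ k)%:R :> R by rewrite ltr0n expn_gt0.
  have -> : bound k *+ nk k = K * ((nk k)%:R / (phi (u k)%:R * ((2 ^ k)%:R * (u k)%:R))).
    by rewrite /bound natrM -[_ *+ nk k]mulr_natr mulrAC -mulrA.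
  apply: ler_wpM2l => //; rewrite ler_pdivrMr; last by rewrite !mulr_gt0.
  by rewrite mulrCA mulKf ?gt_eqF.
rewrite -mulr_sumr mulrC ler_wpM2r //.
suff -> : \sum_(k < N) (2 ^ k)%:R^-1 = 2 - 2 * (2 ^ N)%:R^-1 :> R.
  by rewrite lerBlDr lerDl mulr_ge0 // invr_ge0.
elim: N => [|N IH]; first by rewrite big_ord0 expn0 invr1 mulr1 subrr.
rewrite big_ord_recr /= IH expnS natrM; field.
by rewrite pnatr_eq0 -lt0n expn_gt0.
Qed.

(** The integrals of [excess j] are summable, so [excess j x] tends to 0 almost everywhere. The
    values up to [u k] add at most [pert_len j * u k], which equals [base_len j / 2 ^ k]. *)
Lemma pert_decay : {ae m, forall x, forall eps, 0 < eps -> exists J, forall j,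
  (J <= j)%N -> \sum_(i < pert_len j) `|f (iter (pert_start j + n j * i)%N T x)|
    <= eps * (base_len j)%:R}.
Proof.
have ifin : (\int[m]_x (\sum_(j <oo) (excess j x)%:E) < +oo)%E.
  rewrite integral_nneseries //; last 2 first.
  - by move=> j; exact/measurable_EFinP.
  - by move=> j x _; rewrite lee_fin.
  apply: (@le_lt_trans _ _ (2 * K)%:E); last exact: ltry.
  apply: lime_le.
    by apply: is_cvg_nneseries => j _ _; apply: integral_ge0 => x _; rewrite lee_fin.
  apply: nearW => N; rewrite big_mkord.
  apply: (@le_trans _ _ (\sum_(j < N) (bound (level nk j))%:E)%E).
    by apply: lee_sum => j _; exact: excess_integral.
  by rewrite sumEFin lee_fin; exact: sum_bound.
have mS : measurable_fun setT (fun x => \sum_(j <oo) (excess j x)%:E)%E.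
  apply: ge0_emeasurable_sum => [j x _ _|j _]; first by rewrite lee_fin.
  exact/measurable_EFinP.
have S0 x : (0 <= \sum_(j <oo) (excess j x)%:E)%E.
  by apply: nneseries_ge0 => j _ _; rewrite lee_fin.
have Si : m.-integrable setT (fun x => \sum_(j <oo) (excess j x)%:E)%E.
  by apply/integrableP; split => //; under eq_integral do rewrite gee0_abs //.
apply: filterS (integrable_ae measurableT Si) => x /(_ I).
rewrite ge0_fin_numE // => hx eps eps0.
have e2 : 0 < eps / 2 by lra.
have [J1 h1] := nneseries_lty_eventually (excess_ge0 ^~ x) hx e2.
pose J2 := Num.bound (2 / eps).
exists (maxn J1 (lex_start nk J2)) => j hj.
have /h1 {}h1 := leq_trans (leq_maxl _ _) hj.
have kJ2 : (J2 <= level nk j)%N.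
  by apply: lex_ge => //; exact: leq_trans (leq_maxr _ _) hj.
set k := level nk j in kJ2 *.
have l0 : 0 < (base_len j)%:R :> R.
  by rewrite ltr0n; exact: base_len_gt0 level_ratio_gt0 level_step_gt0 j.
apply: (@le_trans _ _ (\sum_(i < pert_len j)
   ((u k)%:R + tail k (iter (pert_start j + n j * i)%N T x)))).
  by apply: ler_sum => i _; exact: fE.
rewrite big_split /= sumr_const card_ord [eps]splitr mulrDl; apply: lerD; last first.
  by rewrite mulrC -ler_pdivrMl.
rewrite base_lenE natrM -[_ *+ pert_len j]mulr_natr mulrA ler_wpM2r //.
rewrite /level_ratio -/k natrM mulrA -[leLHS]mul1r ler_wpM2r //.
rewrite mulrC -ler_pdivrMr // div1r invf_div.
rewrite (@le_trans _ _ J2%:R) //.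
  by rewrite ltW // archi_boundP // divr_ge0 // ltW.
by rewrite ler_nat (leq_trans kJ2) // ltnW // ltn_expl.
Qed.

End PerturbationDecay.

Lemma ae_of_small_exceptions (R : realType) (d : measure_display)
    (X : measurableType d) (m : probability X R) (P : X -> Prop) :
  (forall eta : R, 0 < eta -> exists A : set X,
    [/\ measurable A, (m A <= eta%:E)%E & forall x, ~ A x -> P x]) ->
  {ae m, forall x, P x}.
Proof.
move=> h.
have /choice[A hA] : forall i : nat, exists A : set X,
    [/\ measurable A, (m A <= (i.+1%:R^-1)%:E)%E & forall x, ~ A x -> P x].
  by move=> i; apply: h; rewrite invr_gt0.
have mA i : measurable (A i) by have [] := hA i.
have mcap : measurable (\bigcap_i A i) by exact: bigcap_measurable.
exists (\bigcap_i A i); split => //.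
  apply/eqP; rewrite eq_le measure_ge0 andbT.
  apply/lee_addgt0Pr => eps eps0; rewrite add0e.
  pose i := Num.bound (eps^-1).
  apply: (@le_trans _ _ (m (A i))).
    by apply: le_measure_subset => // x; apply.
  have [_ + _] := hA i => /le_trans; apply; rewrite lee_fin invf_ple ?posrE //.
  rewrite (le_trans (ltW (archi_boundP _))) ?invr_ge0 ?ltW // ltr_nat //.
move=> x /= nPx i _; apply: contrapT => nA; apply: nPx.
by have [_ _] := hA i; apply.
Qed.

Lemma perturbed_seq_good (R : realType) (phi : R -> R) (u nk : nat -> nat) :
  {homo phi : x y / x <= y} -> (forall x, 1 <= phi x) ->
  (forall k, (0 < u k)%N) -> (forall k, (0 < nk k)%N) ->
  (forall k, (nk k)%:R <= phi (u k)%:R * (u k)%:R) ->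
  universally_good (Lclass phi) (perturbed_seq u nk).
Proof.
move=> phi_ndecr phi_ge1 u_gt0 nk_gt0 nk_le d X m T [mT Tinv _] f hf.
(* The constant 1 belongs to the class as well; applied to it, [pert_decay] shows that the
   perturbation times have density zero. *)
have h1 : Lclass phi m (cst 1 : X -> R).
  split; first exact: measurable_cst.
  rewrite (eq_integral (cst (phi 1)%:E)) => [|x _]; last by rewrite /= normr1 mul1r.
  rewrite integral_cst //; apply: lte_mul_pinfty => //.
    by rewrite lee_fin (le_trans ler01).
  exact: le_lt_trans (probability_le1 m measurableT) (ltry _).
have fi := Lclass_integrable phi_ndecr phi_ge1 hf.
have e_gt0 := level_ratio_gt0 nk u_gt0.
have n_gt0 := level_step_gt0 nk_gt0.
pose isb := is_base (level_ratio u nk) (level_step nk) (residue nk).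
(* Only the values [1 / k.+1] of [lam] are used, so that countably many null sets are discarded. *)
pose P k x := exists l D : R, 0 <= D /\ forall N,
  `|\sum_(t < N | isb t) (f (iter (perturbed_seq u nk t) T x) - l)|
     <= D + k.+1%:R^-1 * N%:R.
have hP k : {ae m, forall x, P k x}.
  apply: ae_of_small_exceptions => eta eta0.
  by apply: base_sum_near => //; rewrite invr_gt0.
have := ae_foralln hP.
apply: filterS3 (pert_decay mT Tinv phi_ndecr phi_ge1 u_gt0 nk_gt0 nk_le hf)
  (pert_decay mT Tinv phi_ndecr phi_ge1 u_gt0 nk_gt0 nk_le h1).
move=> x hpert hpert1 hbase.
apply: (@cvg_block_average _ isb (fun t => f (iter (perturbed_seq u nk t) T x))).
- move=> lam lam0; have [l [D [D0 hD]]] := hbase (Num.bound lam^-1).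
  exists l, D; split => // N; rewrite (le_trans (hD N)) // lerD2l ler_wpM2r //.
  rewrite invf_ple ?posrE //.
  rewrite (le_trans (ltW (archi_boundP _))) ?invr_ge0 ?ltW // ltr_nat //.
- move=> lam lam0; have [J hJ] := hpert _ lam0.
  exact: (@pert_sum_le _ _ _ _ e_gt0 n_gt0 (fun s => `|f (iter s T x)|) lam J (ltW lam0)).
- move=> lam lam0; have [J hJ] := hpert1 _ lam0.
  apply: (@pert_sum_le _ _ _ _ e_gt0 n_gt0 (fun s => 1) lam J (ltW lam0)) => // j /hJ.
  by under eq_bigr do rewrite normr1.
Qed.

(** * Markers and covering sets in aperiodic systems *)

Section Markers.
Context (R : realType) (d : measure_display) (X : measurableType d).
Variables (m : probability X R) (T : X -> X).
Hypothesis mT : measurable_fun setT T.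
Hypothesis Tinv : forall A : set X, measurable A -> m (T @^-1` A) = m A.

(* Greedy choice of return-separated sets out of [C 0, C 1, ...]: a point of
   [C r] is added unless it lies within distance [H] of a point already chosen.
   As [T] need not be invertible, the rule at stage [r] reads the whole window
   of radius [H] off the future orbit: [marker C H r] is the set chosen in the
   first [r] stages, shifted by [r * H]. *)
Fixpoint marker (C : nat -> set X) (H r : nat) : set X :=
  if r is r'.+1 then
    iter H T @^-1` marker C H r' `|`
    (iter (r * H) T @^-1` C r' `&`
     [set w | forall j, (j <= 2 * H)%N -> ~ marker C H r' (iter j T w)])
  else set0.

Lemma measurable_marker C H r : (forall i, measurable (C i)) -> measurable (marker C H r).
Proof.
move=> mC; elim: r => //= r IH; apply: measurableU.
  exact: measurable_iter_preimage.
apply: measurableI; first exact: measurable_iter_preimage.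
rewrite (_ : [set w | _] = \bigcap_(j in [set j | (j <= 2 * H)%N])
    iter j T @^-1` (~` marker C H r)); last by apply/seteqP; split => w h j jH; exact: h.
apply: bigcap_measurable => [|j _]; first by exists 0%N.
by apply: measurable_iter_preimage => //; exact: measurableC.
Qed.

(** Old points keep their distances under the shift by [H]; a new point is added only if no old
    point lies within distance [H] of it; two new points both come from [C r], which is
    return-free. *)
Lemma marker_separated C H r :
  (forall k i x, (0 < i <= H)%N -> C k x -> ~ C k (iter i T x)) ->
  forall i x, (0 < i <= H)%N -> marker C H r x -> ~ marker C H r (iter i T x).
Proof.
move=> hC; elim: r => [|r IH] i x hi; first by [].
move=> [h1|[h1 h2]] [h3|[h3 h4]].
- by apply: (IH i _ hi h1); rewrite -iterD addnC iterD.
- apply: (h4 (H - i)%N); first lia.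
  by rewrite -iterD (_ : H - i + i = H)%N //; lia.
- apply: (h2 (H + i)%N); first lia.
  by rewrite iterD.
- by apply: (hC r i _ hi h1); rewrite -iterD addnC iterD.
Qed.

(** Induction on the number of stages: each shifts by [H], so [p] becomes [p + H] one stage earlier.
    At the stage that treats [C k], either the point is added or a chosen point in its window
    prevents this. The condition [H <= p] keeps all times nonnegative. *)
Lemma marker_hit C H r k p x : (k < r)%N -> (H <= p)%N ->
  C k (iter (p + r * H) T x) ->
  exists j, [/\ (p <= j + H)%N, (j <= p + H)%N & marker C H r (iter j T x)].
Proof.
elim: r p => // r IH p kr Hp Ckx.
have shift j : (H <= j)%N -> marker C H r (iter j T x) ->
    marker C H r.+1 (iter (j - H) T x).
  by move=> Hj h; left; rewrite /preimage /= -iterD subnKC.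
move: kr; rewrite ltnS leq_eqVlt => /orP[/eqP kE|kr]; last first.
  have [||j [j1 j2 hj]] := IH (p + H)%N kr; [lia|by rewrite -addnA -mulSn|].
  by exists (j - H)%N; split; [lia|lia|apply: shift hj; lia].
have [[j [j1 hj]]|h] := pselect (exists j, (j <= 2 * H)%N /\ marker C H r (iter (j + p) T x)).
  by exists (j + p - H)%N; split; [lia|lia|apply: shift hj; lia].
exists p; split; [lia|lia|right; split].
  by move: Ckx; rewrite kE addnC iterD.
by move=> j j1 hj; apply: h; exists j; split => //; rewrite iterD.
Qed.

End Markers.

Section Towers.
Context (R : realType) (d : measure_display) (X : measurableType d).
Variables (m : probability X R) (T : X -> X).
Hypothesis mT : measurable_fun setT T.
Hypothesis Tinv : forall A : set X, measurable A -> m (T @^-1` A) = m A.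
Hypothesis T_aperiodic : forall n, (0 < n)%N -> m.-negligible [set x | iter n T x = x].
Hypothesis m_separated : ae_countably_separated m.

Definition cell (A : nat -> set X) (s : seq (nat * bool)) : set X :=
  [set x | forall ib, ib \in s -> if ib.2 then A ib.1 x else ~ A ib.1 x].

(** Finite membership patterns are coded by natural numbers, so that the greedy choice can process
    these sets one after another. *)
Definition return_free_cell (A : nat -> set X) (H k : nat) : set X :=
  if @unpickle (seq (nat * bool)) k is Some s then
    cell A s `&` [set x | forall i, (0 < i <= H)%N -> ~ cell A s (iter i T x)]
  else set0.

Lemma measurable_cell A s : (forall i, measurable (A i)) -> measurable (cell A s).
Proof.
move=> mA; elim: s => [|[i b] s IH].
  by rewrite (_ : cell A [::] = setT) //; apply/seteqP; split.
rewrite (_ : cell A ((i, b) :: s) = (if b then A i else ~` A i) `&` cell A s).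
  by apply: measurableI => //; case: b => //; exact: measurableC.
apply/seteqP; split => x.
  move=> h; split; first by have := h (i, b); rewrite inE eqxx => /(_ isT); case: b {h}.
  by move=> jb js; apply: h; rewrite inE js orbT.
move=> [h1 h2] jb; rewrite inE => /orP[/eqP ->|]; last exact: h2.
by case: b h1.
Qed.

Lemma measurable_return_free_cell A H k :
  (forall i, measurable (A i)) -> measurable (return_free_cell A H k).
Proof.
move=> mA; rewrite /return_free_cell; case: unpickle => // s.
have mc := measurable_cell s mA; apply: measurableI => //.
rewrite (_ : [set x | _] = \bigcap_(i in [set i | (0 < i <= H)%N]) ~` (iter i T @^-1` cell A s)).
  case: H => [|H].
    rewrite (_ : [set i | _] = set0) ?bigcap_set0 //.
    by apply/seteqP; split => // i /=; lia.
  apply: bigcap_measurable => [|i _]; first by exists 1%N.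
  by apply: measurableC; exact: measurable_iter_preimage.
by apply/seteqP; split => x h i hi; exact: h.
Qed.

Lemma return_free_cellP A H k i x : (0 < i <= H)%N ->
  return_free_cell A H k x -> ~ return_free_cell A H k (iter i T x).
Proof.
rewrite /return_free_cell; case: unpickle => // s hi [_ h] [h' _].
exact: h hi h'.
Qed.

(** Each of the next [H] iterates differs from [x], hence is separated from it by some [A a];
    imposing these finitely many conditions gives a cell around [x] that none of the iterates
    enters. *)
Lemma return_free_cell_cover A (Z : set X) H x :
  (forall y z, ~ Z y -> ~ Z z -> (forall i, A i y <-> A i z) -> y = z) ->
  (forall i, (i <= H)%N -> ~ Z (iter i T x)) ->
  (forall i, (0 < i <= H)%N -> iter i T x <> x) ->
  exists k, return_free_cell A H k x.
Proof.
move=> sepA xZ xper.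
suff [s [s1 s2]] : exists s, cell A s x /\
    forall i, (0 < i <= H)%N -> ~ cell A s (iter i T x).
  by exists (pickle s); rewrite /return_free_cell pickleK.
elim: H xZ xper => [|H IH] xZ xper.
  by exists [::]; split => // i; lia.
have [i iH|i iH|s [s1 s2]] := IH; first exact/xZ/leqW.
  by apply: xper; lia.
have [a ha] : exists a, ~ (A a x <-> A a (iter H.+1 T x)).
  apply: contrapT => /forallNP h; apply: (xper H.+1); first lia.
  apply/esym; apply: sepA => [||i]; first exact: (xZ 0%N).
    exact: xZ.
  exact: contrapT (h i).
exists ((a, `[< A a x >]) :: s); split.
  move=> ib; rewrite inE => /orP[/eqP ->|]; last exact: s1.
  by case: ifPn => /= [/asboolP|/asboolP].
move=> i; rewrite andbC leq_eqVlt => /andP[/orP[/eqP ->|iH] i0].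
  move=> /(_ (a, `[< A a x >])); rewrite inE eqxx => /(_ isT) /=.
  by case: asboolP => h1 h2; apply: ha; split.
move=> h; apply: (s2 i); first by rewrite i0.
by move=> ib ibs; apply: h; rewrite inE ibs orbT.
Qed.

Definition unhit (G : set X) (L : nat) : set X :=
  [set x | forall j, (j <= L)%N -> ~ G (iter j T x)].

Lemma measurable_unhit G L : measurable G -> measurable (unhit G L).
Proof.
move=> mG; have -> : unhit G L = run_set T (~` G) L by [].
by apply: measurable_run_set => //; exact: measurableC.
Qed.

(** By aperiodicity and separation the sets [C k] cover almost every point, so for some [r] the
    first [r] of them miss a set [B r] of measure at most [eps]. If the orbit of a point avoids the
    marker up to time [2 * H], it is in [B r] at time [H + r * H]. *)
Lemma marker_exists H (eps : R) : 0 < eps ->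
  exists G : set X, [/\ measurable G,
    forall i x, (0 < i <= H)%N -> G x -> ~ G (iter i T x) &
    (m (unhit G (2 * H)) <= eps%:E)%E].
Proof.
move=> eps0; have [A [Z [mA Z0 sepA]]] := m_separated.
pose C := return_free_cell A H.
have mC k : measurable (C k) by exact: measurable_return_free_cell.
pose B r := \bigcap_(k in `I_r) ~` C k.
have mB r : measurable (B r).
  case: r => [|r]; first by rewrite /B II0 bigcap_set0.
  by apply: bigcap_measurable => [|k _]; [exists 0%N => //=|exact: measurableC].
have mBinf : measurable (\bigcap_r B r) by exact: bigcap_measurable.
have Binf0 : m (\bigcap_r B r) = 0%E.
  apply/negligibleP => //.
  have [Z' [mZ' Z'0 ZZ']] := Z0.
  apply: (@negligibleS _ _ _ _ ((\bigcup_i iter i T @^-1` Z')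
      `|` \bigcup_i [set x | iter i.+1 T x = x])); last first.
    apply: negligibleU; apply: negligible_bigcup => i; last exact: T_aperiodic.
    apply/negligibleP; first exact: measurable_iter_preimage.
    exact: eq_trans (measure_iter mT Tinv i mZ') Z'0.
  move=> x hx; apply: contrapT => /not_orP[h1 h2].
  have [i iH|i hi|k Ckx] := @return_free_cell_cover A Z H x sepA.
  - by move=> /ZZ' h; apply: h1; exists i.
  - by move=> h; apply: h2; exists i.-1 => //=; case: i hi h.
  - by apply: (hx k.+1 I k) => //=.
have cvB : m (B r) @[r --> \oo] --> 0%E.
  rewrite -Binf0; apply: nonincreasing_cvg_mu => //.
    exact: le_lt_trans (probability_le1 m (mB 0%N)) (ltry _).
  apply/nonincreasing_seqP => r; apply/subsetPset => x h k kr; apply: h.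
  exact: leq_trans kr _.
have [r hr] := cvge0_exists_le cvB eps0.
exists (marker T C H r); split.
- exact: measurable_marker.
- by apply: marker_separated => k i x; exact: return_free_cellP.
apply: (@le_trans _ _ (m (iter (H + r * H) T @^-1` B r))); last by rewrite measure_iter.
apply: le_measure_subset.
- by apply: measurable_unhit; exact: measurable_marker.
- exact: measurable_iter_preimage.
move=> x hx k kr Ckx.
have [j [_ j2 hj]] := marker_hit kr (leqnn H) Ckx.
by apply: (hx j) => //; lia.
Qed.

(** The separation of [G] gives [m G <= 1 / H.+1], and [E] is a union of [q] preimages of [G] at
    times spaced by [n], where [q * n <= 3 * H.+1]. If the orbit of [x] meets [G] at a time [t]
    between [W] and [W + 2 * H], it lies in [E] at every time [p <= W] congruent to [t] modulo
    [n]. *)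
Lemma sweeping_set (n W : nat) (eps : R) : (0 < n)%N -> 0 < eps ->
  exists E B : set X, [/\ measurable E, measurable B,
    (m E <= (3 / n%:R)%:E)%E, (m B <= eps%:E)%E &
    forall x, ~ B x -> exists2 c, (c < n)%N &
      forall p, (p <= W)%N -> (p %% n = c)%N -> E (iter p T x)].
Proof.
move=> n0 eps0; pose H := (W + n)%N.
have [G [mG sepG hitG]] := marker_exists H eps0.
pose q := ((W + 2 * H) %/ n).+1.
have mGi i : measurable (iter (n * i) T @^-1` G) by exact: measurable_iter_preimage.
exists (\big[setU/set0]_(i < q) (iter (n * i) T @^-1` G)).
(* Taking the preimage under [iter W T] makes the hitting time at least [W], hence not before any
   [p <= W]. *)
exists (iter W T @^-1` unhit G (2 * H)); split.
- by apply: bigsetU_measurable => i _.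
- by apply: measurable_iter_preimage => //; exact: measurable_unhit.
- have hG : (H.+1%:R%:E * m G <= 1)%E.
    have -> : (H.+1%:R%:E * m G = \sum_(i < H.+1) m (iter i T @^-1` G))%E.
      rewrite (eq_bigr (fun=> m G)) => [|i _]; last exact: measure_iter.
      by rewrite sumr_const card_ord mule_natl.
    rewrite -(@probability_setT _ _ _ m).
    apply: (@sum_measure_disjoint_le _ _ _ m (fun i => iter i T @^-1` G)) => //.
      by move=> i; exact: measurable_iter_preimage.
    move=> i j ij jH; apply/seteqP; split => // x [xi xj].
    apply: (sepG (j - i)%N _ _ xi); first by move: jH => /=; lia.
    by rewrite -iterD subnK // ltnW.
  have hE : (m (\big[setU/set0]_(i < q) (iter (n * i) T @^-1` G)) <= q%:R%:E * m G)%E.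
    apply: (@le_trans _ _ (\sum_(i < q) m (iter (n * i) T @^-1` G))%E).
      exact: (@Boole_inequality _ _ _ m (fun i => iter (n * i) T @^-1` G)).
    rewrite (eq_bigr (fun=> m G)) => [|i _]; last exact: measure_iter.
    by rewrite sumr_const card_ord mule_natl.
  apply: (le_trans hE); move: hG.
  have [a a0 ->] : exists2 a, 0 <= a & m G = a%:E.
    by exists (fine (m G)); rewrite ?fine_ge0 // fineK // fin_num_prob.
  rewrite -!EFinM !lee_fin => hG.
  have hq : (q * n <= 3 * H.+1)%N.
    have := leq_trunc_div (W + 2 * H) n; rewrite /q mulSn /H; lia.
  have n0' : 0 < n%:R :> R by rewrite ltr0n.
  rewrite ler_pdivlMr // mulrAC -natrM.
  apply: (@le_trans _ _ ((3 * H.+1)%:R * a)); first by rewrite ler_wpM2r // ler_nat.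
  rewrite natrM -mulrA -[leRHS]mulr1 ler_wpM2l //.
- by rewrite measure_iter //; exact: measurable_unhit.
move=> x /= hx.
have [j [jH Gj]] : exists j, (j <= 2 * H)%N /\ G (iter j T (iter W T x)).
  by apply: contrapT => /forallNP h; apply: hx => j j1 Gj; apply: (h j).
exists ((j + W) %% n)%N; first by rewrite ltn_mod.
move=> p pW pmod.
have pt : (p <= j + W)%N by lia.
have /dvdnP[i hi] : (n %| (j + W) - p)%N by rewrite -eqn_mod_dvd // pmod.
rewrite -(bigcup_mkord q (fun i => iter (n * i) T @^-1` G)).
exists i => /=.
  by rewrite /q ltnS leq_divRL // -hi; lia.
by rewrite /preimage /= -iterD mulnC -hi subnK // iterD.
Qed.

End Towers.

(** * Sweeping out *)

Section SweepingAverages.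
Variable R : realType.
Variables u nk : nat -> nat.
Hypothesis u_gt0 : forall k, (0 < u k)%N.
Hypothesis nk_gt0 : forall k, (0 < nk k)%N.

Local Notation e := (level_ratio u nk).
Local Notation n := (level_step nk).
Local Notation c := (residue nk).

Definition height (k : nat) : R := (4 ^ k * u k)%:R.

(** This is the start of the first stage of level [k.+1]; it bounds all terms of the levels up to
    [k], so orbits need to be controlled only up to this time. *)
Definition level_window (k : nat) : nat := base_start e n c (lex_start nk k.+1).

(* The average is taken over the terms up to the end of the perturbation block
   of the stage with level [k] and residue [r]; these are at most
   [3 * base_len j = 3 * 2 ^ k * u k * pert_len j] terms. *)
Lemma level_average_ge (F : nat -> R) (k r : nat) : (r < nk k)%N ->
  (forall s, 0 <= F s) ->
  (forall p, (p <= level_window k)%N -> (p %% nk k = r)%N -> height k <= F p) ->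
  exists N, 2 ^+ k / 3 <= N.+1%:R^-1 * \sum_(t < N.+1) F (perturbed_seq u nk t).
Proof.
move=> rn F0 hF.
have e_gt0 := level_ratio_gt0 nk u_gt0.
have n_gt0 := level_step_gt0 nk_gt0.
pose j := (lex_start nk k + r)%N.
have lexj : lex nk j = (k, r) by exact: lex_startD.
have ej : e j = (2 ^ k * u k)%N by rewrite /level_ratio /level lexj.
have nj : n j = nk k by rewrite /level_step /level lexj.
have cj : c j = r by rewrite /residue lexj.
have jk : (j.+1 <= lex_start nk k.+1)%N by rewrite lex_startS /j; lia.
pose l := base_len e n c j; pose p := pert_len e n c j.
have p0 : (0 < p)%N by exact: pert_len_gt0.
have posS : stage_pos e n c j.+1 = (stage_pos e n c j + (l + p))%N by exact: stage_posS.
have pos_gt0 : (0 < stage_pos e n c j.+1)%N by rewrite posS; lia.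
exists (stage_pos e n c j.+1).-1; rewrite prednK //.
have Nle : (stage_pos e n c j.+1 <= 3 * l)%N.
  have h1 := @stage_pos_le e n c n_gt0 j; have h2 := @base_len_start e n c e_gt0 j.
  have h3 := @base_len_ge e n c e_gt0 j; rewrite posS -/l -/p in h1 h2 h3 *.
  by move: (leq_trans h1 h2) h3; rewrite -/l -/p; lia.
have N0 : 0 < (stage_pos e n c j.+1)%:R :> R by rewrite ltr0n.
(* Only the last perturbation block is kept: its terms are congruent to [r] modulo [nk k], and all
   other summands are nonnegative. *)
have S_ge : p%:R * height k <= \sum_(t < stage_pos e n c j.+1) F (perturbed_seq u nk t).
  rewrite (bigID (fun t : 'I_(stage_pos e n c j.+1) => is_base e n c t)) /=.
  apply: ler_wpDl; first exact: sumr_ge0.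
  rewrite posS (@big_pert e n c e_gt0 n_gt0 R F j (l + p)) //.
  apply: ler_wpDl; first by apply: sumr_ge0 => j' _; exact: sumr_ge0.
  rewrite addKn.
  apply: (@le_trans _ _ (\sum_(i < p) height k)).
    by rewrite sumr_const card_ord mulr_natl.
  apply: ler_sum => i _; apply: hF.
    apply: (@leq_trans (base_start e n c j.+1)); last exact: base_start_le.
    by rewrite base_startS leq_add2l leq_mul2l ltnW ?orbT.
  by rewrite /pert_start nj cj addnAC -mulnDr [X in (X + _)%N]mulnC modnMDl modn_small.
rewrite ler_pdivlMl //; apply: le_trans S_ge.
apply: (@le_trans _ _ ((3 * l)%:R * (2 ^+ k / 3))).
  by rewrite ler_wpM2r ?divr_ge0 ?exprn_ge0 // ler_nat.
have -> : (3 * l)%:R * (2 ^+ k / 3) = l%:R * 2 ^+ k :> R.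
  by rewrite natrM; field.
rewrite /l /base_len ej -/p /height !natrM !natrX.
have -> : 4 = 2 * 2 :> R by ring.
by rewrite exprMn le_eqVlt; apply/orP; left; apply/eqP; ring.
Qed.

End SweepingAverages.

Section Sweeping.
Context (R : realType) (d : measure_display) (X : measurableType d).
Variables (m : probability X R) (T : X -> X).
Hypothesis mT : measurable_fun setT T.
Hypothesis Tinv : forall A : set X, measurable A -> m (T @^-1` A) = m A.
Variables (h : nat -> R) (E : nat -> set X).
Hypothesis h_ge0 : forall k, 0 <= h k.
Hypothesis h_incr : forall i k, (i <= k)%N -> h i <= h k.
Hypothesis mE : forall k, measurable (E k).

Let top_layer k := E k `\` \bigcup_(i in [set i | (k < i)%N]) E i.

Let mtop k : measurable (top_layer k).
Proof. by apply: measurableD => //; exact: bigcup_measurable. Qed.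

(* The value [h k] for the largest [k] with [x] in [E k]; [0] if there is none. *)
Definition layered (x : X) : R :=
  if pselect (exists k, top_layer k x) is left ex then h (projT1 (cid ex)) else 0.

Lemma top_layer_inj i k x : top_layer i x -> top_layer k x -> i = k.
Proof.
move=> [Ei hi] [Ek hk]; apply/eqP; rewrite eqn_leq; apply/andP.
split; rewrite leqNgt; apply/negP => lt; [apply: hk|apply: hi].
  by exists i.
by exists k.
Qed.

Lemma layered_top k x : top_layer k x -> layered x = h k.
Proof.
move=> hk; rewrite /layered; case: pselect => [ex|]; last by case; exists k.
by case: (cid ex) => i hi /=; rewrite (top_layer_inj hi hk).
Qed.

Lemma layered_none x : ~ (exists k, top_layer k x) -> layered x = 0.
Proof. by move=> nx; rewrite /layered; case: pselect. Qed.

Lemma layered_ge0 x : 0 <= layered x.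
Proof. by rewrite /layered; case: pselect. Qed.

Lemma measurable_layered : measurable_fun setT layered.
Proof.
move=> _ Y mY; rewrite setTI.
rewrite (_ : _ @^-1` _ = \bigcup_(k in [set k | Y (h k)]) top_layer k
    `|` (if `[< Y 0 >] then ~` (\bigcup_k top_layer k) else set0)).
  apply: measurableU; first exact: bigcup_measurable.
  by case: ifP => // _; apply: measurableC; exact: bigcup_measurable.
apply/seteqP; split => x.
  move=> Yx; have [[k hk]|nx] := pselect (exists k, top_layer k x).
    by left; exists k => //=; rewrite -(layered_top hk).
  right; move: Yx; rewrite /preimage /= layered_none // => Y0.
  by rewrite asboolT // => -[k _ hk]; apply: nx; exists k.
move=> [[k /= Yk hk]|]; first by rewrite /preimage /= (layered_top hk).
case: ifP => // /asboolP Y0 nx; rewrite /preimage /= layered_none //.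
by move=> [k hk]; apply: nx; exists k.
Qed.

(** Off the upper limit of the sets, [x] lies in finitely many of them, so there is a largest index
    [i] with [x] in [E i]; then [k <= i], and [h] is nondecreasing. *)
Lemma layered_ge k x : ~ lim_sup_set E x -> E k x -> h k <= layered x.
Proof.
move=> nlim Ek.
have [N hN] : exists N, forall i, (N <= i)%N -> ~ E i x.
  apply: contrapT => /forallNP nN; apply: nlim => N _.
  have /existsNP[i /not_implyP[Ni /contrapT Ei]] := nN N.
  by exists i.
have [i [ki Ei hi]] : exists i, [/\ (k <= i)%N, E i x & forall i', (i < i')%N -> ~ E i' x].
  have bnd i : `[< E i x >] -> (i <= N)%N.
    by move=> /asboolP Ei; rewrite leqNgt; apply/negP => Ni; exact: hN (ltnW Ni) Ei.
  have ex : exists i, `[< E i x >] by exists k; apply/asboolP.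
  case: (ex_maxnP ex bnd) => i /asboolP Ei hmax; exists i; split => //.
    by apply: hmax; apply/asboolP.
  by move=> i' ii' /asboolP /hmax; rewrite leqNgt ii'.
rewrite (@layered_top i) ?h_incr //; split => // -[i' /= ii' Ei'].
exact: hi ii' Ei'.
Qed.

(** At each point the integrand is 0 or a single [v k] with [x] in [E k], hence at most the series
    of [v k * \1_(E k)], which is integrated term by term. *)
Lemma layered_Lclass (psi : R -> R) (C : nat -> R) : {homo psi : x y / x <= y} ->
  (forall x, 0 <= psi x) ->
  (forall k, (m (E k) <= (C k)%:E)%E) ->
  (forall k, h k * psi (h k) * C k <= 3 / (2 ^ k.+1)%:R) ->
  Lclass psi m layered.
Proof.
move=> psi_ndecr psi0 EC hC; split; first exact: measurable_layered.
have mpsi : measurable_fun setT psi by exact: nondecreasing_measurable.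
pose v k := h k * psi (h k).
have v0 k : 0 <= v k by rewrite mulr_ge0.
have mv k : measurable_fun setT (fun x => (v k * \1_(E k) x)%:E).
  by apply/measurable_EFinP/measurable_funM => //; exact: measurable_indic.
have v0E k x : (0 <= (v k * \1_(E k) x)%:E)%E by rewrite lee_fin mulr_ge0.
apply: (@le_lt_trans _ _ (\int[m]_x (\sum_(k <oo) (v k * \1_(E k) x)%:E))%E).
  apply: ge0_le_integral => //.
  - by move=> x _; rewrite lee_fin mulr_ge0.
  - have ml : measurable_fun setT (fun x => `|layered x|).
      exact: (measurableT_comp (@normr_measurable R setT) measurable_layered).
    apply/measurable_EFinP/measurable_funM => //.
    exact: (measurableT_comp mpsi ml).
  - by apply: ge0_emeasurable_sum.
  move=> x _; rewrite (ger0_norm (layered_ge0 x)).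
  have [[k hk]|nx] := pselect (exists k, top_layer k x); last first.
    by rewrite layered_none // mul0r nneseries_ge0.
  rewrite (layered_top hk) -/(v k).
  have h1 := @nneseries_lim_ge R (fun k => (v k * \1_(E k) x)%:E) xpredT 0 k.+1
    (fun k _ _ => v0E k x).
  apply: le_trans h1; rewrite big_mkord big_ord_recr /= indicE mem_set; last by case: hk.
  by rewrite mulr1 leeDr // sume_ge0.
rewrite integral_nneseries //.
apply: (@le_lt_trans _ _ 3%:E); last exact: ltry.
apply: (le_trans _ (epsilon_trick0 xpredT (ler0n R 3))).
apply: lee_nneseries => [k _ _|k _]; first exact: integral_ge0.
under eq_integral do rewrite EFinM.
rewrite ge0_integralZl_EFin //; last first.
  by apply/measurable_EFinP; exact: measurable_indic.
rewrite integral_indic // setIT.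
apply: (@le_trans _ _ ((v k)%:E * (C k)%:E)%E).
  by apply: lee_wpmul2l; [rewrite lee_fin|exact: EC].
by rewrite -EFinM lee_fin; exact: hC.
Qed.

End Sweeping.

Lemma ae_not_lim_sup_set (R : realType) (d : measure_display)
    (X : measurableType d) (m : probability X R) (F : nat -> set X) (C : R) :
  (forall k, measurable (F k)) -> 0 <= C ->
  (forall k, (m (F k) <= (C / (2 ^ k.+1)%:R)%:E)%E) ->
  m.-negligible (lim_sup_set F).
Proof.
move=> mF C0 hF; apply/negligibleP.
  apply: bigcap_measurable => [|k _]; first by exists 0%N.
  by apply: bigcup_measurable.
apply: lim_sup_set_cvg0 => //; apply: (@le_lt_trans _ _ C%:E); last exact: ltry.
apply: (le_trans _ (epsilon_trick0 xpredT C0)).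
by apply: lee_nneseries => // k _; exact: hF.
Qed.

Lemma perturbed_seq_sweeping (R : realType) (psi : R -> R) (u nk : nat -> nat) :
  {homo psi : x y / x <= y} -> (forall x, 1 <= psi x) ->
  (forall k, (0 < u k)%N) -> (forall k, (u k <= u k.+1)%N) ->
  (forall k, (0 < nk k)%N) ->
  (forall k, height R u k * psi (height R u k) <= (nk k)%:R / (2 ^ k.+1)%:R) ->
  universally_sweeping_out (Lclass psi) (perturbed_seq u nk).
Proof.
move=> psi_ndecr psi_ge1 u_gt0 u_ndecr nk_gt0 hh d X m T sep [mT Tinv aper].
pose h := height R u.
have h_ge1 k : 1 <= h k.
  by rewrite /h /height ler1n muln_gt0 expn_gt0 u_gt0.
have h_ge0 k : 0 <= h k by exact: le_trans (h_ge1 k).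
have h_incr i k : (i <= k)%N -> h i <= h k.
  move=> /subnK <-; elim: (k - i)%N => // j IH; rewrite addSn (le_trans IH) //.
  by rewrite /h /height ler_nat leq_mul // leq_exp2l.
have psi0 x : 0 <= psi x by exact: le_trans (psi_ge1 x).
have half_gt0 k : 0 < 1 / (2 ^ k.+1)%:R :> R by rewrite divr_gt0 // ltr0n expn_gt0.
have /choice[E hE] : forall k, exists E : set X, exists B : set X,
    [/\ measurable E, measurable B, (m E <= (3 / (nk k)%:R)%:E)%E,
      (m B <= (1 / (2 ^ k.+1)%:R)%:E)%E &
      forall x, ~ B x -> exists2 r, (r < nk k)%N &
        forall p, (p <= level_window u nk k)%N -> (p %% nk k = r)%N -> E (iter p T x)].
  by move=> k; exact: sweeping_set.
have /choice[B hB] := hE.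
have mE k : measurable (E k) by have [] := hB k.
have mB k : measurable (B k) by have [] := hB k.
(* Both [h k] and [psi (h k)] are at least 1, so [hh] forces [2 ^ k.+1 <= nk k]; hence the measures
   of the [E k] are summable. *)
have nk_half k : 1 / (nk k)%:R <= 1 / (2 ^ k.+1)%:R :> R.
  rewrite !div1r lef_pV2 ?posrE ?ltr0n ?expn_gt0 //.
  have := hh k; rewrite ler_pdivlMr ?ltr0n ?expn_gt0 //; apply: le_trans.
  by rewrite -[leLHS]mul1r ler_wpM2r // -[1]mulr1 ler_pM.
exists (layered h E).
  apply: (layered_Lclass h_ge0 mE psi_ndecr psi0 (C := fun k => 3 / (nk k)%:R)) => k.
    by have [] := hB k.
  have n0 : 0 < (nk k)%:R :> R by rewrite ltr0n.
  rewrite mulrCA ler_pM2l // ler_pdivrMr // [leRHS]mulrC; exact: hh.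
have limB0 : m.-negligible (lim_sup_set B).
  by apply: (@ae_not_lim_sup_set _ _ _ m B 1) => // k; have [] := hB k.
have limE0 : m.-negligible (lim_sup_set E).
  apply: (@ae_not_lim_sup_set _ _ _ m E 3) => // k.
  have [_ _ + _ _] := hB k => /le_trans; apply; rewrite lee_fin.
  by rewrite ler_wpM2l //; have := nk_half k; rewrite !div1r.
(* The averages evaluate the function along the orbit, so every iterate has to avoid the upper limit
   set. *)
have limE p : {ae m, forall x, ~ lim_sup_set E (iter p T x)}.
  have [N [mN N0 sN]] := limE0.
  exists (iter p T @^-1` N); split.
  - exact: measurable_iter_preimage.
  - exact: eq_trans (measure_iter mT Tinv p mN) N0.
  - by move=> x /= /contrapT /sN.
have limB : {ae m, forall x, ~ lim_sup_set B x}.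
  by apply: negligibleS limB0 => x /= /contrapT.
apply: filterS2 limB (ae_foralln limE) => x xB xE.
have [K0 hK0] : exists K0, forall k, (K0 <= k)%N -> ~ B k x.
  apply: contrapT => /forallNP nK; apply: xB => K _.
  have /existsNP[k /not_implyP[Kk /contrapT Bk]] := nK K.
  by exists k.
apply/eqyP => M M0.
(* From [K0] on, [x] is outside [B k], and [3 * M <= k <= 2 ^ k] makes the average at least [M]. *)
pose k := maxn K0 (Num.bound (3 * M)).
have Mk : M <= 2 ^+ k / 3.
  rewrite ler_pdivlMr // mulrC (le_trans (ltW (archi_boundP _))) ?mulr_ge0 ?(ltW M0) //.
  by rewrite -natrX ler_nat (leq_trans (leq_maxr K0 _)) // ltnW // ltn_expl.
have [_ _ _ _ /(_ x (hK0 _ (leq_maxl _ _)))[r rn hr]] := hB k.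
have [N hN] := level_average_ge u_gt0 nk_gt0 (F := fun s => layered h E (iter s T x)) rn
  (fun s => layered_ge0 E h_ge0 _)
  (fun p pW pr => layered_ge h_incr (@xE p) (hr p pW pr)).
apply: (@le_trans _ _ (2 ^+ k / 3)%:E); first by rewrite lee_fin.
apply: le_trans (ereal_sup_ubound _); last by exists N.
by rewrite lee_fin.
Qed.

(** * Growth of the weights and the choice of scales *)

Section Growth.
Variable R : realType.
Variables psi phi : R -> R.
Hypothesis psi_le1 : forall x, x <= 1 -> psi x = 1.
Hypothesis psi_incr : forall x y, 1 <= x -> x < y -> psi x < psi y.

Lemma weight_homo : {homo psi : x y / x <= y}.
Proof.
move=> x y xy; have [y1|y1] := leP y 1.
  by rewrite !psi_le1 // (le_trans xy).
have [x1|x1] := leP x 1.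
  by rewrite psi_le1 // -(psi_le1 (lexx 1)) ltW // psi_incr.
move: xy; rewrite le_eqVlt => /orP[/eqP -> //|xy].
by rewrite ltW // psi_incr // ltW.
Qed.

Lemma weight_ge1 x : 1 <= psi x.
Proof.
have [x1|x1] := leP x 1; first by rewrite psi_le1.
by rewrite -(psi_le1 (lexx 1)) ltW // psi_incr.
Qed.

End Growth.

(* Otherwise [phi] would at least double along [2 ^ 2 ^ i], whose logarithm
   doubles as well, which contradicts [phi = o(ln)]. *)
Lemma slow_growth_squares (R : realType) (phi : R -> R) (N0 : nat) :
  (forall x, 1 <= phi x) ->
  phi x / ln x @[x --> +oo] --> (0 : R) ->
  exists2 i, (N0 <= i)%N & phi (2 ^ 2 ^ i.+1)%N%:R <= 2 * phi (2 ^ 2 ^ i)%N%:R.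
Proof.
move=> phi_ge1 cv; apply: contrapT => hno.
have hgt i : (N0 <= i)%N -> 2 * phi (2 ^ 2 ^ i)%N%:R < phi (2 ^ 2 ^ i.+1)%N%:R.
  by move=> hi; rewrite ltNge; apply/negP => hle; apply: hno; exists i.
have hpow i : 2 ^+ i <= phi (2 ^ 2 ^ (N0 + i))%N%:R.
  elim: i => [|i IH]; first by rewrite expr0 phi_ge1.
  rewrite addnS exprS (le_trans _ (ltW (hgt _ _))) ?leq_addr //.
  by rewrite ler_wpM2l.
(* With this value, [phi x < eps * ln x < 2 ^ i], because [ln x < 2 ^ (N0 + i).+1]; this contradicts
   [hpow i]. *)
pose eps : R := (2 ^+ N0.+1)^-1.
have eps0 : 0 < eps by rewrite invr_gt0 exprn_gt0.
have /cvgrPdist_lt /(_ _ eps0)[M [_ hM]] := cv.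
pose i := (Num.bound `|M|).+1.
pose x : R := (2 ^ 2 ^ (N0 + i))%N%:R.
have xM : M < x.
  apply: (@le_lt_trans _ _ `|M|); first exact: ler_norm.
  apply: (lt_trans (archi_boundP (normr_ge0 M))).
  rewrite ltr_nat (ltn_trans _ (ltn_expl _ (ltnSn 1))) //.
  by rewrite (ltn_trans _ (ltn_expl _ (ltnSn 1))) // /i addnS ltnS leq_addl.
have x0 : 0 < (2 ^ 2 ^ (N0 + i))%N%:R :> R by rewrite ltr0n expn_gt0.
have lnx : ln x < 2 ^+ (N0 + i).+1.
  have -> : ln x = ln 2 * 2 ^+ (N0 + i) by rewrite /x natrX lnXn // -[LHS]mulr_natr natrX.
  by rewrite exprS ltr_pM2r ?exprn_gt0 // ln_sublinear.
have lnx0 : 0 < ln x.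
  by rewrite ln_gt0 // /x ltr1n -[1%N](expn0 2) ltn_exp2l // expn_gt0.
have := hM x xM; rewrite sub0r normrN ger0_norm; last first.
  by rewrite divr_ge0 ?ltW // (lt_le_trans _ (phi_ge1 _)).
rewrite ltr_pdivrMr // => h1.
have := hpow i; rewrite leNgt => /negP; apply; apply: (lt_trans h1).
rewrite /eps -addSn exprD in lnx *.
by rewrite ltr_pdivrMl ?exprn_gt0.
Qed.

(** As [phi x >= 1] and [kappa <= 1], the power is at most [phi x], so the divergence of the ratio
    yields [psi = o(phi)]. *)
Lemma ratio_dominates (R : realType) (psi phi : R -> R) (kappa D : R) :
  (forall x, 0 < psi x) -> (forall x, 1 <= phi x) -> kappa <= 1 ->
  phi x `^ kappa / psi x @[x --> +oo] --> +oo ->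
  exists M, forall x, M < x -> D * psi x <= phi x.
Proof.
move=> psi0 phi1 kappa1 /cvgryPge /(_ D)[M [_ hM]]; exists M => x /hM.
rewrite ler_pdivlMr // => /le_trans; apply.
exact: ler1_powR.
Qed.

(** For [u = 2 ^ 2 ^ i] with [2 * k <= 2 ^ i], the height [4 ^ k * u] is at most [u ^ 2], so [psi]
    of it is at most a small multiple of [phi (u ^ 2) <= 2 * phi u]. *)
Lemma stage_scale (R : realType) (psi phi : R -> R) (kappa : R) (k N0 : nat) :
  {homo psi : x y / x <= y} -> (forall x, 1 <= psi x) -> (forall x, 1 <= phi x) ->
  {homo phi : x y / x <= y} ->
  phi x / ln x @[x --> +oo] --> (0 : R) -> kappa <= 1 ->
  phi x `^ kappa / psi x @[x --> +oo] --> +oo ->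
  exists2 i, (N0 <= i)%N & let u := fun _ : nat => (2 ^ 2 ^ i)%N in
    height R u k * psi (height R u k)
      <= (Num.truncn (phi (u k)%:R * (u k)%:R))%:R / (2 ^ k.+1)%:R.
Proof.
move=> psi_ndecr psi1 phi1 phi_ndecr philog kappa1 ratio.
have psi0 x : 0 < psi x by exact: lt_le_trans (psi1 x).
(* In this factor [2 ^ k.+1] and [4 ^ k] come from the goal, one 2 from [phi (u ^ 2) <= 2 * phi u],
   and one 2 from the truncation. *)
have [M hM] := ratio_dominates (2 ^+ k.+3 * 4 ^+ k) psi0 phi1 kappa1 ratio.
have [i hi hphi] := slow_growth_squares (maxn N0 (maxn (2 * k) (Num.bound `|M|))) phi1 philog.
exists i; first exact: leq_trans (leq_maxl _ _) hi.
move=> u; rewrite /height /u.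
pose U : R := (2 ^ 2 ^ i)%N%:R.
have U0 : 0 < U by rewrite ltr0n expn_gt0.
have ki : (2 * k <= 2 ^ i)%N.
  rewrite (leq_trans _ (ltnW (ltn_expl i (ltnSn 1)))) // (leq_trans _ hi) //.
  by rewrite (leq_trans _ (leq_maxr _ _)) // leq_maxl.
have UM : M < (2 ^ 2 ^ i.+1)%N%:R.
  apply: (@le_lt_trans _ _ `|M|); first exact: ler_norm.
  apply: (lt_trans (archi_boundP (normr_ge0 M))).
  rewrite ltr_nat (leq_ltn_trans _ (ltn_expl _ (ltnSn 1))) //.
  rewrite (leq_trans _ (ltnW (ltn_expl _ (ltnSn 1)))) // leqW //.
  by rewrite (leq_trans _ hi) // (leq_trans _ (leq_maxr _ _)) // leq_maxr.
have kU : (4 ^ k * 2 ^ 2 ^ i <= 2 ^ 2 ^ i.+1)%N.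
  by rewrite expnS mul2n -addnn expnD leq_mul2r -[4%N]/(2 ^ 2)%N -expnM leq_exp2l // ki orbT.
have psi_le : 2 ^+ k.+2 * 4 ^+ k * psi (4 ^ k * 2 ^ 2 ^ i)%N%:R <= phi U.
  have h1 := hM _ UM.
  have h2 : psi (4 ^ k * 2 ^ 2 ^ i)%N%:R <= psi (2 ^ 2 ^ i.+1)%N%:R.
    by apply: psi_ndecr; rewrite ler_nat.
  pose w : R := 2 ^+ k.+2 * 4 ^+ k.
  have w0 : 0 <= w by rewrite mulr_ge0 // exprn_ge0.
  apply: le_trans (ler_wpM2l w0 h2) _.
  have := le_trans h1 hphi; rewrite -(ler_pM2l (ltr0Sn R 1)) => /(le_trans _); apply.
  by rewrite /w (exprS 2 k.+2) !mulrA.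
have phiU1 : 1 <= phi U * U.
  by rewrite -[1]mulr1 ler_pM // ler1n expn_gt0.
have trunc_ge : phi U * U / 2 <= (Num.truncn (phi U * U))%:R.
  have := truncnS_gt (phi U * U); rewrite -natr1.
  have : 1 <= (Num.truncn (phi U * U))%:R :> R by rewrite ler1n truncn_gt0.
  lra.
rewrite ler_pdivlMr ?ltr0n ?expn_gt0 //; apply: le_trans trunc_ge.
rewrite -/U ler_pdivlMr // !natrM -/U !natrX.
rewrite [leLHS](_ : _ = 2 ^+ k.+2 * 4 ^+ k * psi (4 ^ k * 2 ^ 2 ^ i)%N%:R * U).
  by rewrite ler_wpM2r // ltW.
by rewrite natrM -/U natrX (exprS 2 k.+1); ring.
Qed.

Theorem lemma1p1 (R : realType) (psi phi : R -> R)
  (psi_gt0 : forall x, 0 < psi x)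
  (phi_gt0 : forall x, 0 < phi x)
  (psi_unbounded : ~ [bounded psi x | x in [set: R]])
  (phi_unbounded : ~ [bounded phi x | x in [set: R]])
  (psi_le1 : forall x, x <= 1 -> psi x = 1)
  (phi_le1 : forall x, x <= 1 -> phi x = 1)
  (psi_incr : forall x y, 1 <= x -> x < y -> psi x < psi y)
  (phi_incr : forall x y, 1 <= x -> x < y -> phi x < phi y)
  (phi_log : forall j : R, 0 < j ->
    phi x / (ln x `^ j) @[x --> +oo] --> (0 : R))
  (phi_psi : exists2 k : R, 0 < k &
    (phi u `^ (k / (k + 1))) / psi u @[u --> +oo] --> +oo) :
  exists a : nat -> nat,
    [/\ forall n, (0 < a n)%N,
        forall m n, (m < n)%N -> (a m < a n)%N,
        universally_good (Lclass phi) a &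
        universally_sweeping_out (Lclass psi) a].
Proof.
have [k0 k0_gt0 ratio] := phi_psi.
have kappa1 : k0 / (k0 + 1) <= 1 by rewrite ler_pdivrMr; lra.
have phi_ndecr := weight_homo phi_le1 phi_incr.
have psi_ndecr := weight_homo psi_le1 psi_incr.
have phi1 := weight_ge1 phi_le1 phi_incr.
have psi1 := weight_ge1 psi_le1 psi_incr.
have philn : phi x / ln x @[x --> +oo] --> (0 : R).
  apply: cvg_trans (phi_log 1 ltr01); apply: near_eq_cvg.
  exists 1; split; first exact: num_real.
  by move=> x x1; rewrite powRr1 // ln_ge0 // ltW.
have /choice[s hs] : forall kN : nat * nat, exists i, (kN.2 <= i)%N /\
    let u := fun _ : nat => (2 ^ 2 ^ i)%N in
    height R u kN.1 * psi (height R u kN.1)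
      <= (Num.truncn (phi (u kN.1)%:R * (u kN.1)%:R))%:R / (2 ^ kN.1.+1)%:R.
  move=> [k N0].
  have [i h1 h2] := stage_scale k N0 psi_ndecr psi1 phi1 phi_ndecr philn kappa1 ratio.
  by exists i.
(* Each exponent is chosen at least as large as the preceding one, which makes [u] nondecreasing. *)
pose idx := fix idx k := if k is k'.+1 then s (k, idx k') else s (0%N, 0%N).
pose u k := (2 ^ 2 ^ idx k)%N.
pose nk k := Num.truncn (phi (u k)%:R * (u k)%:R).
have u_gt0 k : (0 < u k)%N by rewrite expn_gt0.
have phiu1 k : 1 <= phi (u k)%:R * (u k)%:R.
  apply: (@le_trans _ _ (1 * 1)); first by rewrite mulr1.
  by apply: ler_pM => //; rewrite ler1n.
have nk_gt0 k : (0 < nk k)%N by rewrite truncn_gt0.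
have nk_le k : (nk k)%:R <= phi (u k)%:R * (u k)%:R.
  by rewrite truncn_le (le_trans ler01).
have u_ndecr k : (u k <= u k.+1)%N.
  by rewrite !leq_exp2l //; have [] := hs (k.+1, idx k).
have hh k : height R u k * psi (height R u k) <= (nk k)%:R / (2 ^ k.+1)%:R.
  by case: k => [|k]; [have [] := hs (0%N, 0%N)|have [] := hs (k.+1, idx k)].
exists (perturbed_seq u nk); split.
- move=> t; apply: block_seq_gt0; exact: level_step_gt0.
- move=> i j; apply: block_seq_lt; [exact: level_ratio_gt0|exact: level_step_gt0].
- exact: perturbed_seq_good.
- exact: perturbed_seq_sweeping.
Qed.
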